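(* Let $p$ be a prime, let $a\ge1$ and $b\ge0$ be integers, $r\ge1$, and let $(F,G,Z)$ be an $a$-approximate triple of matrices in $\mathbb{Z}_p^{r\times r}$. Then the procedure Hensel_qf (described in the context), applied to $(F,G,Z,a,b)$, is well defined, terminates, and returns a matrix $F'\in\mathbb{Z}_p^{r\times r}$ such that $$(F'-F)_{(i,j)}\equiv 0\mod p^{a+\max(i-j,0)}\qquad\text{for all } i,j,$$ and such that the triple $(F',G,Z)$ is $b$-approximate.
   Context: Notation. A symmetric matrix over $\mathbb{Z}_p$ is unimodular if it is invertible over $\mathbb{Z}_p$, and $p^i$-modular if it is $p^i$ times a unimodular symmetric matrix. Let $G\in\mathbb{Z}_p^{r\times r}$ be a symmetric block-diagonal matrix with $p^i$-modular blocks $G_{(i)}$ of size $r_i\ge0$ (indexed by $i\ge0$, in increasing order). Every $r\times r$ matrix $M$ is divided accordingly into blocks $M_{(i,j)}$ of size $r_i\times r_j$. An invertible matrix $F\in\mathbb{Z}_p^{r\times r}$ (invertible over $\mathbb{Z}_p$) is $G$-compatible if $F_{(i,j)}\equiv0\bmod p^{\max(i-j,0)}$ for all $i,j$. Oddity vector. For $p=2$, an oddity vector of a unimodular symmetric matrix $S\in\mathbb{Z}_2^{k\times k}$ is a row vector $v$ with $vSx^{\top}\equiv xSx^{\top}\bmod2$ for all $x\in\mathbb{Z}_2^k$ (unique modulo $2$); an oddity vector of a $2^i$-modular matrix $2^iS$ is one of $S$. $a$-approximate. For an integer $a\ge0$, $(F,G,Z)$ is $a$-approximate if $G\in\mathbb{Z}_p^{r\times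 r}$ is a symmetric block-diagonal matrix with $p^i$-modular blocks $G_{(i)}$ of size $r_i\ge0$ (indexed by $i\ge0$, in increasing order), $F$ is $G$-compatible, $Z\in\mathbb{Z}_p^{r\times r}$ is symmetric, and (i) $(FGF^\top-Z)_{(i,j)}\equiv0\bmod p^{a+\max(i,j)}$ for all $i,j$; (ii) if $p=2$: $((FGF^\top-Z)_{(i,i)})_{k,k}\equiv0\bmod2^{a+i+1}$ for all $i$ and all $k\in\{1,\dots,r_i\}$; (iii) if $p=2$ and $a=1$: $v_i(FGF^\top-Z)_{(i,i)}v_i^\top\equiv0\bmod2^{i+3}$ for all $i$, where $v_i$ is the oddity vector of $Z_{(i,i)}$. Procedure Hensel_qf_unimodular$(F,G,Z,a,b)$, for $G$ unimodular and $(F,G,Z)$ $a$-approximate with $a\ge1$: Case $p\ne2$. While $a<b$: put $A=FGF^\top-Z$, replace $F$ by $F-\frac12A(GF^\top)^{-1}$ and then $a$ by $2a$. Return $F$. Case $p=2$. If $a=1$: put $A=FGF^\top-Z$, choose a solution $X\in\mathbb{Z}_2^{r\times r}$ of $X+X^\top\equiv2^{-1}A\bmod2$ and $X_{k,k}+\sum_{l=1}^rX_{k,l}(Z^{-1})_{l,l}\equiv2^{-2}A_{k,k}\bmod2$ for $k=1,\dots,r$; replace $F$ by $F-2X(GF^\top)^{-1}$ and set $a=2$. Then, while $a<b$: put $A=FGF^\top-Z$, write $A=N+N^\top+D$ with $N$ strictly upper triangular and $D$ diagonal, replace $F$ by $F-(N+2^{-1}D)(GF^\top)^{-1}$ and then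 $a$ by $2a-1$. Return $F$. Procedure Hensel_qf$(F,G,Z,a,b)$: 1. Let $i_1=\min\{i: r_i\ne0\}$ and $G_1=G_{(i_1)}$; write $F=\begin{pmatrix} F_{11} & F_{12} \\ F_{21} & F_{22} \end{pmatrix}$, $G=\begin{pmatrix} G_1 & 0 \\ 0 & G_2 \end{pmatrix}$, $Z=\begin{pmatrix} Z_{11} & Z_{12} \\ Z_{21} & Z_{22} \end{pmatrix}$ with $F_{11},Z_{11}$ of the size of $G_1$. 2. Put $Z_{11}'=Z_{11}-F_{12}G_2F_{12}^\top$ and replace $F_{11}$ by Hensel_qf_unimodular$(F_{11},p^{-i_1}G_1,p^{-i_1}Z_{11}',a,b)$. 3. If $G_2$ is empty (i.e. $G=G_1$), return $F$. Otherwise let $s=\min\{j-i_1: j>i_1,\ r_j\ne0\}$. 4. While $a<b$: put $Z_{22}'=Z_{22}-F_{21}G_1F_{21}^\top$; replace $F_{22}$ by Hensel_qf$(F_{22},G_2,Z_{22}',a,a+s)$ (recursive call, keeping the block indices); then replace $F_{21}$ by $(Z_{21}-F_{22}G_2F_{12}^\top)(G_1F_{11}^\top)^{-1}$; then replace $a$ by $a+s$. 5. Return $F$. *)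

(* Defs.v *)
From HB Require Import structures.
From mathcomp Require Import all_boot all_order all_algebra.
From mathcomp Require Import boolp.

Set Implicit Arguments.
Unset Strict Implicit.
Unset Printing Implicit Defensive.

Import Order.TTheory GRing.Theory Num.Theory.
Local Open Scope ring_scope.

(* The ring Z_p as the inverse limit of the Z/p^n: the n-th term of a sequence
   is the representative in [0, p^n[ of the residue class modulo p^n. *)
Definition padic_seq (p : nat) (x : nat -> int) : Prop :=
  forall n, (x n.+1 %% (p ^ n)%:Z)%Z = x n.

Record padic (p : nat) (pp : prime p) : Type := Padic {
  padic_val :> nat -> int;
  padic_valP : padic_seq p padic_val
}.

HB.instance Definition _ p (pp : prime p) := gen_eqMixin (padic pp).
HB.instance Definition _ p (pp : prime p) := gen_choiceMixin (padic pp).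

Section PadicRing.
Variables (p : nat) (pp : prime p).
Local Notation Zp := (padic pp).
Local Notation q n := ((p ^ n)%:Z).

Lemma padic_eq (x y : Zp) : (forall n, x n = y n) -> x = y.
Proof.
case: x y => [x hx] [y hy] /= /funext exy.
by move: hx hy; rewrite exy => hx hy; congr Padic; apply: Prop_irrelevance.
Qed.

Lemma modz_q i j z : ((z %% q (i + j)%N)%Z %% q i)%Z = (z %% q i)%Z.
Proof.
rewrite [in RHS](divz_eq z (q (i + j)%N)).
by rewrite (_ : _ * q (i + j)%N = (z %/ q (i + j)%N)%Z * q j * q i) ?modzMDl //
           -mulrA -PoszM -expnD addnC.
Qed.

Lemma modz_qS n z : ((z %% q n.+1)%Z %% q n)%Z = (z %% q n)%Z.
Proof. by rewrite -addn1 modz_q. Qed.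

Lemma padic_mod (x : Zp) n : (x n %% q n)%Z = x n.
Proof. by rewrite -(padic_valP x n) modz_mod. Qed.

Lemma padic_modS (x : Zp) n : (x n.+1 = x n %[mod q n])%Z.
Proof. by rewrite padic_valP padic_mod. Qed.

Lemma padic_mk_subproof (f : nat -> int) :
  (forall n, (f n.+1 = f n %[mod q n])%Z) ->
  padic_seq p (fun n => (f n %% q n)%Z).
Proof. by move=> hf n; rewrite modz_qS hf. Qed.

Definition padic_mk f hf : Zp := Padic pp (@padic_mk_subproof f hf).

Definition padic_int (m : int) : Zp := @padic_mk (fun _ => m) (fun _ => erefl).

Lemma padic_opp_subproof (x : Zp) n : (- x n.+1 = - x n %[mod q n])%Z.
Proof. by rewrite -modzNm padic_modS modzNm. Qed.
Definition padic_opp x := padic_mk (padic_opp_subproof x).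

Lemma padic_add_subproof (x y : Zp) n :
  (x n.+1 + y n.+1 = x n + y n %[mod q n])%Z.
Proof. by rewrite -modzDm !padic_modS modzDm. Qed.
Definition padic_add x y := padic_mk (padic_add_subproof x y).

Lemma padic_mul_subproof (x y : Zp) n :
  (x n.+1 * y n.+1 = x n * y n %[mod q n])%Z.
Proof. by rewrite -modzMm !padic_modS modzMm. Qed.
Definition padic_mul x y := padic_mk (padic_mul_subproof x y).

Lemma padic_addA : associative padic_add.
Proof. by move=> x y z; apply: padic_eq => n /=; rewrite modzDml modzDmr addrA. Qed.
Lemma padic_addC : commutative padic_add.
Proof. by move=> x y; apply: padic_eq => n /=; rewrite addrC. Qed.
Lemma padic_add0 : left_id (padic_int 0) padic_add.
Proof. by move=> x; apply: padic_eq => n /=; rewrite modzDml add0r padic_mod. Qed.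
Lemma padic_addN : left_inverse (padic_int 0) padic_opp padic_add.
Proof. by move=> x; apply: padic_eq => n /=; rewrite modzDml addNr. Qed.

HB.instance Definition _ := GRing.isZmodule.Build Zp
  padic_addA padic_addC padic_add0 padic_addN.

Lemma padic_mulA : associative padic_mul.
Proof. by move=> x y z; apply: padic_eq => n /=; rewrite modzMml modzMmr mulrA. Qed.
Lemma padic_mulC : commutative padic_mul.
Proof. by move=> x y; apply: padic_eq => n /=; rewrite mulrC. Qed.
Lemma padic_mul1 : left_id (padic_int 1) padic_mul.
Proof. by move=> x; apply: padic_eq => n /=; rewrite modzMml mul1r padic_mod. Qed.
Lemma padic_mulD : left_distributive padic_mul padic_add.
Proof.
by move=> x y z; apply: padic_eq => n /=; rewrite modzMml modzDm mulrDl.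
Qed.
Lemma padic_1neq0 : padic_int 1 != 0.
Proof.
apply/eqP => /(congr1 (fun x : Zp => x 1%N)) /=.
by rewrite expn1 mod0z modz_small //= ltz_nat prime_gt1.
Qed.

HB.instance Definition _ := GRing.Zmodule_isComNzRing.Build Zp
  padic_mulA padic_mulC padic_mul1 padic_mulD padic_1neq0.

Definition padic_unit : {pred Zp} := fun x => `[< exists y, y * x = 1 >].

Definition padic_inv (x : Zp) : Zp :=
  if pselect (exists y, y * x = 1) is left h then projT1 (cid h) else x.

Lemma padic_mulV : {in padic_unit, left_inverse 1 padic_inv *%R}.
Proof.
move=> x /asboolP ux; rewrite /padic_inv; case: pselect => // h.
exact: (projT2 (cid h)).
Qed.

Lemma padic_unitP (x y : Zp) : y * x = 1 -> padic_unit x.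
Proof. by move=> yx; apply/asboolP; exists y. Qed.

Lemma padic_inv_out : {in [predC padic_unit], padic_inv =1 id}.
Proof.
move=> x /negP nux; rewrite /padic_inv; case: pselect => // h.
by case: nux; apply/asboolP.
Qed.

HB.instance Definition _ := GRing.ComNzRing_hasMulInverse.Build Zp
  padic_mulV padic_unitP padic_inv_out.

Lemma padic_modD (x : Zp) i j : (x (i + j)%N %% q i)%Z = x i.
Proof.
elim: j => [|j IHj]; first by rewrite addn0 padic_mod.
by rewrite addnS -(modz_q i j) padic_valP.
Qed.

Lemma padic_integral : GRing.integral_domain_axiom Zp.
Proof.
move=> x y xy0; case: (eqVneq x 0) => //= x0; apply/eqP/padic_eq => j.
have [i xi] : exists i, x i <> 0.
  by apply/existsNP => h; case/eqP: x0; apply: padic_eq => n; rewrite h /= mod0z.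
rewrite [RHS]mod0z -(padic_modD y j i); apply/dvdz_mod0P.
have /dvdz_mod0P : (x (j + i)%N * y (j + i)%N %% q (j + i))%Z = 0.
  by have /(congr1 (fun z : Zp => z (j + i)%N)) /= := xy0; rewrite mod0z.
have : ~~ (q i %| x (j + i)%N)%Z.
  by apply/dvdz_mod0P; rewrite addnC padic_modD.
rewrite !dvdzE /= abszM.
have [->|y0] := posnP `|y (j + i)%N|; first by rewrite dvdn0.
have [->|x1] := posnP `|x (j + i)%N|; first by rewrite dvdn0.
rewrite !pfactor_dvdn ?muln_gt0 ?x1 ?y0 // lognM // -ltnNge => lt_i le_ij.
by rewrite -(leq_add2r i) (leq_trans le_ij) // addnC leq_add2l ltnW.
Qed.

HB.instance Definition _ := GRing.ComUnitRing_isIntegral.Build Zp padic_integral.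

End PadicRing.

(* A nondeterministic partial computation is given by its set of possible
   outcomes; the outcome None stands for an undefined operation, or for a loop
   stopped before its exit condition holds. *)
Definition prog (T : Type) : Type := option T -> Prop.

Definition ret T (x : T) : prog T := fun o => o = Some x.

Definition abort T : prog T := fun o => o = None.

Definition bind T U (c : prog T) (f : T -> prog U) : prog U := fun o =>
  (c None /\ o = None) \/ (exists2 x, c (Some x) & f x o).

Definition select T (P : T -> Prop) : prog T := fun o =>
  (exists2 x, P x & o = Some x) \/ ((forall x, ~ P x) /\ o = None).

Definition ensure (P : Prop) : prog unit := select (fun _ => P).

Notation "'let*' x := c 'in' k" := (bind c (fun x => k))
  (at level 200, x binder, c at level 200, k at level 200,
   format "'[v' 'let*'  x  :=  c  'in' '/' k ']'").

(* At most [fuel] iterations; running out of fuel aborts. *)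
Fixpoint while S (fuel : nat) (test : S -> bool) (body : S -> prog S) (s : S) :
    prog S :=
  if test s then
    if fuel is fuel'.+1 then
      let* s' := body s in while fuel' test body s'
    else @abort S
  else ret s.

(* For a list [rs] of block sizes, [reshape_index rs] maps each row to the index
   of its block. *)
Lemma card_reshape_index (rs : seq nat) i :
  #|[pred k : 'I_(sumn rs) | reshape_index rs k == i]| = nth 0%N rs i.
Proof.
have lt_f (c : 'I_(nth 0%N rs i)) : (flatten_index rs i c < sumn rs)%N.
  exact: flatten_indexP.
rewrite -[RHS]card_ord -(card_imset _ (f := fun c => Ordinal (lt_f c))).
  apply: eq_card => k; rewrite !inE; apply/eqP/imsetP => [ki|[c _ ->] /=].
    have lt_k : (reshape_offset rs k < nth 0%N rs i)%N by rewrite -ki reshape_offsetP.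
    exists (Ordinal lt_k) => //.
    by apply: val_inj; rewrite /= -ki reshape_indexK.
  exact: flatten_indexKl.
move=> c d /(congr1 (reshape_offset rs \o val)) /=.
by rewrite !flatten_indexKr // => /val_inj.
Qed.

Section HenselQF.
Variables (p : nat) (pp : prime p).
Local Notation Zp := (padic pp).

Definition zero_mod (m : nat) (x : Zp) : Prop := exists y, x = m%:R * y.

Definition mx_zero_mod (m : nat) k l (M : 'M[Zp]_(k, l)) : Prop :=
  forall i j, zero_mod m (M i j).

Definition unimodular k (S : 'M[Zp]_k) : Prop := S^T = S /\ S \in unitmx.

Definition modular (i : nat) k (M : 'M[Zp]_k) : Prop :=
  exists2 S, unimodular S & M = (p ^ i)%:R *: S.

Definition oddity_unimodular k (S : 'M[Zp]_k) (v : 'rV[Zp]_k) : Prop :=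
  forall x : 'rV[Zp]_k, mx_zero_mod 2 (v *m S *m x^T - x *m S *m x^T).

Definition oddity (i : nat) k (M : 'M[Zp]_k) (v : 'rV[Zp]_k) : Prop :=
  exists S, [/\ unimodular S, M = (2 ^ i)%:R *: S & oddity_unimodular S v].

(* A division into blocks is given by the map [lev] sending an index of a row
   (or column) to the index of its block, so that r_i = #|[pred k | lev k == i]|. *)
Definition block r (lev : 'I_r -> nat) (M : 'M[Zp]_r) (i j : nat) :
    'M[Zp]_(#|[pred k | lev k == i]|, #|[pred k | lev k == j]|) :=
  mxsub enum_val enum_val M.

Definition compatible r (lev : 'I_r -> nat) (F : 'M[Zp]_r) : Prop :=
  F \in unitmx /\
  forall i j, mx_zero_mod (p ^ (i - j)) (block lev F i j).

Record approximate r (lev : 'I_r -> nat) (a : nat) (F G Z : 'M[Zp]_r) : Prop := {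
  approx_sym : G^T = G;
  approx_diag : forall i j, i != j -> block lev G i j = 0;
  approx_modular : forall i, modular i (block lev G i i);
  approx_compat : compatible lev F;
  approx_symZ : Z^T = Z;
  approx_blocks : forall i j,
    mx_zero_mod (p ^ (a + maxn i j)) (block lev (F *m G *m F^T - Z) i j);
  approx_diag2 : p = 2%N -> forall i k,
    zero_mod (2 ^ (a + i + 1)) (block lev (F *m G *m F^T - Z) i i k k);
  approx_oddity : p = 2%N -> a = 1%N -> forall i v, oddity i (block lev Z i i) v ->
    mx_zero_mod (2 ^ (i + 3)) (v *m block lev (F *m G *m F^T - Z) i i *m v^T)
}.

(* Exact division by an integer, and by a square matrix invertible over the
   fraction field; undefined if the quotient is not integral. *)
Definition divn_mx (m : nat) k l (A : 'M[Zp]_(k, l)) : prog 'M[Zp]_(k, l) :=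
  select (fun B => m%:R *: B = A).

Definition rdiv_mx k l (A : 'M[Zp]_(k, l)) (B : 'M[Zp]_l) : prog 'M[Zp]_(k, l) :=
  let* _ := ensure (\det B != 0) in
  select (fun X => X *m B = A).

Definition hensel_unimodular_odd (fuel n : nat) (F G Z : 'M[Zp]_n) (a b : nat) :
    prog 'M[Zp]_n :=
  let* s := while fuel (fun s => (s.2 < b)%N)
    (fun s => let: (F, a) := s in
      let A := F *m G *m F^T - Z in
      let* A2 := divn_mx 2 A in
      let* E := rdiv_mx A2 (G *m F^T) in
      ret (F - E, (2 * a)%N))
    (F, a) in
  ret s.1.

Definition hensel_unimodular_start n (F G Z : 'M[Zp]_n) : prog 'M[Zp]_n :=
  let A := F *m G *m F^T - Z in
  let* A2 := divn_mx 2 A in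
  let* d := select (fun d : 'I_n -> Zp => forall k, 4%:R * d k = A k k) in
  let* _ := ensure (Z \in unitmx) in
  let* X := select (fun X : 'M[Zp]_n =>
    mx_zero_mod 2 (X + X^T - A2) /\
    forall k, zero_mod 2 (X k k + \sum_l X k l * invmx Z l l - d k)) in
  let* E := rdiv_mx (2%:R *: X) (G *m F^T) in
  ret (F - E).

Definition hensel_unimodular_even (fuel n : nat) (F G Z : 'M[Zp]_n) (a b : nat) :
    prog 'M[Zp]_n :=
  let* Fa := if a == 1%N then
               let* F' := hensel_unimodular_start F G Z in ret (F', 2%N)
             else ret (F, a) in
  let* s := while fuel (fun s => (s.2 < b)%N)
    (fun s => let: (F, a) := s in
      let A := F *m G *m F^T - Z in
      let* ND := select (fun ND : 'M[Zp]_n * 'M[Zp]_n =>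
        [/\ forall k l : 'I_n, (l <= k)%N -> ND.1 k l = 0,
            is_diag_mx ND.2
          & A = ND.1 + ND.1^T + ND.2]) in
      let* D2 := divn_mx 2 ND.2 in
      let* E := rdiv_mx (ND.1 + D2) (G *m F^T) in
      ret (F - E, (2 * a - 1)%N))
    Fa in
  ret s.1.

(* The precondition of the procedure is part of its being well defined; all
   the rows of G form a single block, of index 0. *)
Definition hensel_unimodular (fuel n : nat) (F G Z : 'M[Zp]_n) (a b : nat) :
    prog 'M[Zp]_n :=
  let* _ := ensure [/\ unimodular G, (1 <= a)%N & approximate (fun=> 0%N) a F G Z] in
  if p == 2%N then hensel_unimodular_even fuel F G Z a b
  else hensel_unimodular_odd fuel F G Z a b.

(* [rs] lists the sizes of the blocks of index i, i + 1, ...; blocks beyond the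
   end of the list are empty. Leading empty blocks are skipped, so that n.+1 is
   the size of the first nonempty block, and i is then its index. *)
Fixpoint hensel_qf (fuel i : nat) (rs : seq nat) {struct rs} :
    'M[Zp]_(sumn rs) -> 'M[Zp]_(sumn rs) -> 'M[Zp]_(sumn rs) -> nat -> nat ->
    prog 'M[Zp]_(sumn rs) :=
  match rs with
  | [::] => fun _ _ _ _ _ => @abort _
  | 0%N :: rs' => @hensel_qf fuel i.+1 rs'
  | n.+1 :: rs' => fun (F G Z : 'M[Zp]_(n.+1 + sumn rs')) a b =>
      let F12 := ursubmx F in
      let G1 := ulsubmx G in let G2 := drsubmx G in
      let Z11' := ulsubmx Z - F12 *m G2 *m F12^T in
      let* G1i := divn_mx (p ^ i) G1 in
      let* Z11i := divn_mx (p ^ i) Z11' in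
      let* F11 := hensel_unimodular fuel (ulsubmx F) G1i Z11i a b in
      if sumn rs' == 0%N then
        ret (block_mx F11 F12 (dlsubmx F) (drsubmx F))
      else
        let s := (find (fun m => m != 0%N) rs').+1 in
        let* t := while fuel (fun t => (t.2 < b)%N)
          (fun t => let: (F21, F22, a) := t in
            let Z22' := drsubmx Z - F21 *m G1 *m F21^T in
            let* F22 := hensel_qf fuel i.+1 F22 G2 Z22' a (a + s) in
            let* F21 := rdiv_mx (dlsubmx Z - F22 *m G2 *m F12^T) (G1 *m F11^T) in
            ret (F21, F22, (a + s)%N))
          (dlsubmx F, drsubmx F, a) in
        let: (F21, F22, _) := t in
        ret (block_mx F11 F12 F21 F22)
  end.

End HenselQF.

(* Main.v *)
From HB Require Import structures.
From mathcomp Require Import all_boot all_order all_algebra.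
From mathcomp Require Import boolp zify ring.
Require Import Defs.

(** The procedure is a Newton iteration carried out block by block.

    Unimodular case. Let A = F G F^T - Z and let B satisfy B + B^T = A. With
    E = B (G F^T)^-1, replacing F by F - E turns the error A into E G E^T
    ([newton_step]), which is divisible by the square of what divides B. For odd
    p one takes B = A/2. For p = 2 one takes B = N + D/2 with A = N + N^T + D;
    halving the diagonal costs one power of 2, so that precision a becomes
    2a - 1, and nothing is gained from a = 1. To leave a = 1 one takes B = 2X
    with X + X^T only congruent to A/2 modulo 2; the diagonal of the new error
    then vanishes modulo 8 exactly when X solves a second congruence, involving
    the diagonal w of Z^-1. Over the field with two elements both congruences
    together form a linear system whose only possible obstruction is a pairing
    with w ([symmetric_solution]). But w is an oddity vector of Z
    ([oddity_inverse]), and the pairing is one quarter of w A w^T, so that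
    condition (iii) is what makes X exist ([start_solvable]).

    General case. Let i be the index of the first nonempty block and split all
    matrices accordingly. [approximate_split] shows that (F, G, Z) is
    a-approximate if and only if F11 approximates Z11 - F12 G2 F12^T after
    division by p^i, F22 approximates Z22 - F21 G1 F21^T, the block F21 has the
    divisibility required by compatibility, and the lower left block of the
    error is small. The first condition is improved once and for all by the
    unimodular procedure. Each round of the loop improves the second one by s
    powers of p by recursion and then solves for F21 exactly. The old F21 solved
    its equation up to precision a, so it moves by a matrix D whose row k is
    divisible by p^(a + L k - i), where L k >= i + s is the block index of k;
    hence F21 G1 F21^T moves only at precision a + s ([off_diagonal_error]), and
    the round ends with all conditions at precision a + s.

    No step loses precision, so the result is even approximate at precision
    max(a, b). A loop runs at most b - a rounds, and a recursive call asks for a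
    gain s of at most the number of remaining blocks, whence the fuel. *)

Set Implicit Arguments.
Unset Strict Implicit.
Unset Printing Implicit Defensive.

Import GRing.Theory.
Local Open Scope ring_scope.

(** * Divisibility and residues of p-adic integers *)

Section ZeroMod.
Variables (p : nat) (pp : prime p).
Implicit Types x y : padic pp.

Lemma zero_mod0 m : zero_mod m (0 : padic pp).
Proof. by exists 0; rewrite mulr0. Qed.

Lemma zero_mod1 x : zero_mod 1 x.
Proof. by exists x; rewrite mul1r. Qed.

Lemma zero_modD m x y : zero_mod m x -> zero_mod m y -> zero_mod m (x + y).
Proof. by case=> u -> [v ->]; exists (u + v); rewrite mulrDr. Qed.

Lemma zero_modN m x : zero_mod m x -> zero_mod m (- x).
Proof. by case=> u ->; exists (- u); rewrite mulrN. Qed.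

Lemma zero_modM m n x y :
  zero_mod m x -> zero_mod n y -> zero_mod (m * n) (x * y).
Proof. by case=> u -> [v ->]; exists (u * v); rewrite natrM mulrACA. Qed.

Lemma zero_modMl m x y : zero_mod m y -> zero_mod m (x * y).
Proof. by move=> hy; rewrite -[m]mul1n; apply: zero_modM => //; apply: zero_mod1. Qed.

Lemma zero_mod_sum m (I : Type) (r : seq I) (P : pred I) (f : I -> padic pp) :
  (forall i, P i -> zero_mod m (f i)) -> zero_mod m (\sum_(i <- r | P i) f i).
Proof.
by move=> hf; apply: big_ind => //; [exact: zero_mod0 | exact: zero_modD].
Qed.

Lemma zero_mod_nat m : zero_mod m (m%:R : padic pp).
Proof. by exists 1; rewrite mulr1. Qed.

Lemma zero_mod_exp i j x : (i <= j)%N -> zero_mod (p ^ j) x -> zero_mod (p ^ i) x.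
Proof.
move=> ij [y ->]; exists ((p ^ (j - i))%:R * y).
by rewrite mulrA -natrM -expnD subnKC.
Qed.

Lemma padic_natE m n : ((m%:R : padic pp) n = m%:Z %% (p ^ n)%:Z)%Z.
Proof.
elim: m => [//|m IHm]; rewrite mulrSr /= IHm modzDm.
by congr (_ %% _)%Z; lia.
Qed.

Lemma padic_natX_neq0 n : (p ^ n)%:R != 0 :> padic pp.
Proof.
rewrite natrX; apply: expf_neq0; apply/eqP => /(congr1 (fun x : padic pp => x 2)).
rewrite padic_natE /= mod0z modz_small; first by have := prime_gt1 pp; lia.
by have := prime_gt1 pp; nia.
Qed.

Lemma zero_mod_cancel i j x :
  zero_mod (p ^ (i + j)) ((p ^ i)%:R * x) -> zero_mod (p ^ j) x.
Proof.
case=> y; rewrite expnD natrM -mulrA => /(mulfI (padic_natX_neq0 i)) ->.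
by exists y.
Qed.

Definition residue (x : padic pp) : 'F_p := (x 1%N)%:~R.

Lemma intr_modp z : ((z %% (p ^ 1)%:Z)%Z)%:~R = z%:~R :> 'F_p.
Proof.
rewrite expn1 [in RHS](divz_eq z p%:Z) [RHS]intrD intrM.
by rewrite -[p%:Z%:~R]/(p%:R) (pcharf0 (pchar_Fp pp)) mulr0 add0r.
Qed.

Lemma residue_zmod : zmod_morphism residue.
Proof.
by move=> x y; rewrite /residue /= intr_modp intrD intr_modp intrN.
Qed.

Lemma residue_monoid : monoid_morphism residue.
Proof.
split; first by rewrite /residue /= intr_modp.
by move=> x y; rewrite /residue /= intr_modp intrM.
Qed.

HB.instance Definition _ :=
  GRing.isZmodMorphism.Build (padic pp) 'F_p residue residue_zmod.
HB.instance Definition _ :=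
  GRing.isMonoidMorphism.Build (padic pp) 'F_p residue residue_monoid.

Lemma residue_eq0 x : (residue x == 0) = (x 1%N == 0).
Proof.
rewrite /residue -(dvdz_pcharf (pchar_Fp pp)).
have e : (x 1%N %% p%:Z)%Z = x 1%N by rewrite -[RHS]padic_mod expn1.
by apply/dvdz_mod0P/eqP; rewrite e.
Qed.

(** Divisibility by p is read off from the first term of the sequence: once it
    vanishes, dividing the shifted sequence termwise by p gives the quotient. *)
Lemma zero_modP x : zero_mod p x <-> residue x = 0.
Proof.
split=> [[y ->]|/eqP].
  by rewrite rmorphM rmorph_nat (pcharf0 (pchar_Fp pp)) mul0r.
rewrite residue_eq0 => /eqP x1.
have dv n : (p%:Z %| x n.+1)%Z.
  by apply/dvdz_mod0P; have := padic_modD x 1 n; rewrite add1n expn1 => ->.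
have p0 : p%:Z != 0 by have := prime_gt0 pp; lia.
have hy n : ((x n.+2 %/ p%:Z)%Z = (x n.+1 %/ p%:Z)%Z %[mod (p ^ n)%:Z])%Z.
  apply/eqP; rewrite eqz_mod_dvd.
  rewrite -(dvdz_mul2r (p := p%:Z)) // mulrBl !(divzK (dv _)) // -PoszM -expnSr.
  by rewrite -eqz_mod_dvd padic_modS.
exists (padic_mk pp hy); apply: padic_eq => n /=.
by rewrite padic_natE modzMm mulrC divzK // padic_valP.
Qed.

(** If x is nonzero modulo p, then its n-th term is prime to p^n; the Bezout
    coefficients inverting these terms are compatible with each other because
    inverses modulo p^n are unique. *)
Lemma padic_unitE x : (x \is a GRing.unit) = (residue x != 0).
Proof.
apply/idP/idP => [ux|]; first by rewrite -unitfE rmorph_unit.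
rewrite residue_eq0 => x1.
have cop n : coprimez (x n) (p ^ n)%:Z.
  case: n => [|n]; first by rewrite expn0 /coprimez gcdz1.
  rewrite /coprimez /gcdz /= -[(_ == _)]/(coprime _ _) coprimeXr // coprime_sym.
  rewrite prime_coprime // -[(_ %| _)%N]/(p%:Z %| x n.+1)%Z.
  apply: contra x1 => /dvdz_mod0P x1; rewrite -[_ == _]/(x 1%N == 0).
  by rewrite -(padic_modD x 1 n) add1n expn1 x1.
(* The Bezout coefficient of x n, an inverse of x n modulo p^n. *)
pose u n := (egcdz (x n) (p ^ n)%:Z).1.
have hu n : ((u n * x n)%R = 1 %[mod (p ^ n)%:Z])%Z.
  rewrite /u; case: egcdzP => /= a b + _.
  by move: (cop n) => /eqP -> <-; rewrite addrC modzMDl.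
have hy n : (u n.+1 = u n %[mod (p ^ n)%:Z])%Z.
  have h1 : ((u n.+1 * x n)%R = 1 %[mod (p ^ n)%:Z])%Z.
    by rewrite -modzMmr -padic_modS modzMmr -modz_qS hu modz_qS.
  by rewrite -[u n.+1]mulr1 -modzMmr -(hu n) modzMmr mulrCA -modzMmr h1 modzMmr mulr1.
apply/unitrP; exists (padic_mk pp hy); suff e : padic_mk pp hy * x = 1.
  by rewrite [x * _]mulrC e.
by apply: padic_eq => n /=; rewrite modzMml hu.
Qed.

Lemma unitmx_residue k (M : 'M[padic pp]_k) :
  (M \in unitmx) = (\det (map_mx residue M) != 0).
Proof. by rewrite unitmxE padic_unitE det_map_mx. Qed.

(** Invertibility only depends on the determinant modulo p, so it is insensitive
    to perturbations divisible by p. *)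
Lemma unitmx_congr k (M N : 'M[padic pp]_k) :
  mx_zero_mod p (M - N) -> (M \in unitmx) = (N \in unitmx).
Proof.
move=> h; rewrite !unitmx_residue; congr (\det _ != 0).
apply/matrixP => i j; rewrite !mxE; apply/eqP; rewrite -subr_eq0 -rmorphB.
by apply/eqP/zero_modP; have := h i j; rewrite !mxE.
Qed.

End ZeroMod.

(** * Total correctness of nondeterministic programs *)

Section Programs.

(** Every outcome is defined and satisfies Q, and there is at least one: the
    total weakest precondition of Q, for a program without input. *)
Definition succeeds T (c : prog T) (Q : T -> Prop) : Prop :=
  (exists o, c o) /\ forall o, c o -> exists2 x, o = Some x & Q x.

Lemma succeeds_impl T (c : prog T) (Q Q' : T -> Prop) :
  (forall x, Q x -> Q' x) -> succeeds c Q -> succeeds c Q'.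
Proof.
move=> QQ' [ex hc]; split=> // o /hc [x -> Qx].
by exists x => //; apply: QQ'.
Qed.

Lemma succeeds_ret T (x : T) (Q : T -> Prop) : Q x -> succeeds (ret x) Q.
Proof. by move=> Qx; split; [exists (Some x) | move=> o ->; exists x]. Qed.

Lemma succeeds_bind T U (c : prog T) (f : T -> prog U) Q :
  succeeds c (fun x => succeeds (f x) Q) -> succeeds (bind c f) Q.
Proof.
case=> [[o co] hc]; split.
  have [x eo [[o' fo'] _]] := hc o co.
  by exists o'; right; exists x => //; rewrite -eo.
move=> o' [[/hc [x //]]|[x /hc [_ [<-] [_ hf]] /hf]] //.
Qed.

Lemma succeeds_select T (P Q : T -> Prop) :
  (exists x, P x) -> (forall x, P x -> Q x) -> succeeds (select P) Q.
Proof.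
move=> [x Px] PQ; split; first by exists (Some x); left; exists x.
move=> o [[y Py ->]|[nP _]]; last by case: (nP x).
by exists y => //; apply: PQ.
Qed.

Lemma succeeds_ensure (P : Prop) (Q : unit -> Prop) :
  P -> Q tt -> succeeds (ensure P) Q.
Proof. by move=> hP hQ; apply: succeeds_select => [|[]]; [exists tt|]. Qed.

(** The variant mu bounds the number of rounds, so fuel mu s is enough. *)
Lemma succeeds_while S (test : S -> bool) (body : S -> prog S)
    (Inv : S -> Prop) (mu : S -> nat) fuel s :
  (forall s, Inv s -> test s -> (0 < mu s)%N) ->
  (forall s, Inv s -> test s ->
     succeeds (body s) (fun s' => Inv s' /\ (mu s' < mu s)%N)) ->
  Inv s -> (mu s <= fuel)%N ->
  succeeds (while fuel test body s) (fun s' => Inv s' /\ ~~ test s').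
Proof.
move=> pos step; elim: fuel s => [|fuel IH] s Is le_s /=.
  case: ifPn => ts; last exact: succeeds_ret.
  by have := pos s Is ts; lia.
case: ifPn => ts; last exact: succeeds_ret.
apply: succeeds_bind; apply: succeeds_impl (step s Is ts) => s' [Is' lt_s].
by apply: IH => //; lia.
Qed.

End Programs.

(** * Matrices with prescribed divisibility of the entries *)

Section Congruences.
Variables (p : nat) (pp : prime p).
Local Notation Zp := (padic pp).

Lemma mx_zero_modP m k l (M : 'M[Zp]_(k, l)) :
  mx_zero_mod m M -> exists Y, M = m%:R *: Y.
Proof.
move=> hM; pose f x y := projT1 (cid (hM x y)).
exists (\matrix_(x, y) f x y); apply/matrixP => x y; rewrite !mxE.
exact: projT2 (cid (hM x y)).
Qed.

Lemma scalemx_natXI i k l : injective ( *:%R (p ^ i)%:R : 'M[Zp]_(k, l) -> _).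
Proof.
move=> M N /matrixP e; apply/matrixP => x y; have := e x y; rewrite !mxE.
exact/mulfI/padic_natX_neq0.
Qed.

(** Divisibility by powers of p with an exponent that depends on the entry. All
    bounds in the argument have this form, and the exponents of a product obey a
    tropical product rule. *)
Definition mxdiv k l (e : 'I_k -> 'I_l -> nat) (M : 'M[Zp]_(k, l)) : Prop :=
  forall x y, zero_mod (p ^ e x y) (M x y).

Lemma mxdivD k l (e : 'I_k -> 'I_l -> nat) M N :
  mxdiv e M -> mxdiv e N -> mxdiv e (M + N).
Proof. by move=> hM hN x y; rewrite mxE; apply: zero_modD. Qed.

Lemma mxdivN k l (e : 'I_k -> 'I_l -> nat) M : mxdiv e M -> mxdiv e (- M).
Proof. by move=> hM x y; rewrite mxE; apply: zero_modN. Qed.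

Lemma mxdivB k l (e : 'I_k -> 'I_l -> nat) M N :
  mxdiv e M -> mxdiv e N -> mxdiv e (M - N).
Proof. by move=> hM hN; apply: mxdivD (mxdivN hN). Qed.

Lemma mxdiv_tr k l (e : 'I_k -> 'I_l -> nat) M :
  mxdiv e M -> mxdiv (fun x y => e y x) M^T.
Proof. by move=> hM x y; rewrite mxE; apply: hM. Qed.

Lemma mxdiv_le k l (e e' : 'I_k -> 'I_l -> nat) M :
  (forall x y, e' x y <= e x y)%N -> mxdiv e M -> mxdiv e' M.
Proof. by move=> ee' hM x y; apply: zero_mod_exp (hM x y). Qed.

Lemma mxdiv0 k l (M : 'M[Zp]_(k, l)) : mxdiv (fun _ _ => 0) M.
Proof. by move=> x y; rewrite expn0; apply: zero_mod1. Qed.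

Lemma mxdivM k l m (f : 'I_k -> 'I_l -> nat) (g : 'I_l -> 'I_m -> nat)
    (h : 'I_k -> 'I_m -> nat) M N :
  (forall x z y, h x y <= f x z + g z y)%N ->
  mxdiv f M -> mxdiv g N -> mxdiv h (M *m N).
Proof.
move=> hfg hM hN x y; rewrite mxE; apply: zero_mod_sum => z _.
by apply: zero_mod_exp (hfg x z y) _; rewrite expnD; apply: zero_modM.
Qed.

Lemma mxdiv_scale i k l (e : 'I_k -> 'I_l -> nat) M :
  mxdiv e M -> mxdiv (fun x y => i + e x y)%N ((p ^ i)%:R *: M).
Proof.
move=> hM x y; rewrite mxE expnD.
by apply: zero_modM => //; apply: zero_mod_nat.
Qed.

Lemma mxdiv_cancel i k l (e : 'I_k -> 'I_l -> nat) M :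
  mxdiv (fun x y => i + e x y)%N ((p ^ i)%:R *: M) -> mxdiv e M.
Proof.
by move=> hM x y; apply: (@zero_mod_cancel _ _ i); have := hM x y; rewrite mxE.
Qed.

End Congruences.

(** * Approximate triples, entry by entry *)

Section Reindexing.
Variables (p : nat) (pp : prime p).
Local Notation Zp := (padic pp).

Section Bijection.
Variables (m n : nat) (e : 'I_m -> 'I_n) (e' : 'I_n -> 'I_m).
Hypotheses (eK : cancel e e') (e'K : cancel e' e).

Lemma mul_colsub_rowsub k l (X : 'M[Zp]_(k, n)) (Y : 'M[Zp]_(n, l)) :
  colsub e X *m rowsub e Y = X *m Y.
Proof.
apply/matrixP => x y; rewrite !mxE (reindex e); last by exists e' => z _.
by apply: eq_bigr => z _; rewrite !mxE.
Qed.

(** A bijective relabelling of the coordinates does not change the values of a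
    bilinear form. *)
Lemma form_sub (v w : 'rV[Zp]_n) (S : 'M[Zp]_n) :
  colsub e v *m mxsub e e S *m (colsub e w)^T = v *m S *m w^T.
Proof.
have -> : mxsub e e S = rowsub e (colsub e S).
  by apply/matrixP => x y; rewrite !mxE.
rewrite mul_colsub_rowsub mulmx_colsub.
have -> : (colsub e w)^T = rowsub e w^T by apply/matrixP => x y; rewrite !mxE.
exact: mul_colsub_rowsub.
Qed.

Lemma unimodular_sub (S : 'M[Zp]_n) : unimodular S -> unimodular (mxsub e e S).
Proof.
case=> sS uS; split; first by rewrite trmx_mxsub sS.
have E (M : 'M[Zp]_n) : mxsub e e M = rowsub e (colsub e M).
  by apply/matrixP => x y; rewrite !mxE.
have E' (M : 'M[Zp]_n) : mxsub e e M = colsub e (rowsub e M).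
  by apply/matrixP => x y; rewrite !mxE.
have /mulmx1_unit [uSe _] : mxsub e e S *m mxsub e e (invmx S) = 1%:M; last exact: uSe.
rewrite (E' S) (E (invmx S)) mul_colsub_rowsub mul_rowsub_mx mulmx_colsub mulmxV //.
apply/matrixP => x y; rewrite !mxE; congr (nat_of_bool _)%:R.
by rewrite (can_eq eK).
Qed.

Lemma mxsubK (M : 'M[Zp]_m) : mxsub e e (mxsub e' e' M) = M.
Proof. by apply/matrixP => x y; rewrite !mxE !eK. Qed.

End Bijection.

(** The part of an approximate triple that concerns one diagonal block as a
    whole and cannot be expressed entry by entry: G, Z and A stand for the i-th
    diagonal blocks of the form, of the target and of the error. *)
Definition local_ok a i k (G Z A : 'M[Zp]_k) : Prop :=
  modular i G /\
  (p = 2%N -> a = 1%N -> forall v, oddity i Z v ->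
     mx_zero_mod (2 ^ (i + 3)) (v *m A *m v^T)).

(** The blocks are enumerated by an opaque bijection; the conditions on a block
    are insensitive to it, which allows passing to the concrete submatrices of a
    block decomposition. *)
Lemma local_ok_bij a i m n (e : 'I_m -> 'I_n) (e' : 'I_n -> 'I_m) G Z A :
  cancel e e' -> cancel e' e -> local_ok a i G Z A ->
  local_ok a i (mxsub e e G) (mxsub e e Z) (mxsub e e A).
Proof.
move=> eK e'K [[S uS ->] oZ]; split.
  exists (mxsub e e S); first exact: unimodular_sub uS.
  by apply/matrixP => x y; rewrite !mxE.
move=> p2 a1 v [T [uT eT oT]].
have eZ : Z = (2 ^ i)%:R *: mxsub e' e' T.
  rewrite -[Z](mxsubK e'K) eT.
  by apply/matrixP => x y; rewrite !mxE.
have oZv : oddity i Z (colsub e' v).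
  exists (mxsub e' e' T); split=> //; first exact: unimodular_sub uT.
  move=> x.
  have -> : x = colsub e' (colsub e x) by apply/matrixP => z y; rewrite !mxE e'K.
  by rewrite !(form_sub e'K eK); apply: oT.
have := oZ p2 a1 _ oZv.
by rewrite -[A in mx_zero_mod _ (_ *m A *m _)](mxsubK e'K) (form_sub e'K eK).
Qed.

Lemma same_image_bij r m n (f : 'I_m -> 'I_r) (h : 'I_n -> 'I_r) :
  injective f -> injective h -> (forall k, (k \in codom f) = (k \in codom h)) ->
  exists e : 'I_m -> 'I_n, exists e' : 'I_n -> 'I_m,
    [/\ cancel e e', cancel e' e & forall x, h (e x) = f x].
Proof.
move=> fI hI fh.
have fP x : f x \in codom h by rewrite -fh codom_f.
have hP y : h y \in codom f by rewrite fh codom_f.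
exists (fun x => iinv (fP x)), (fun y => iinv (hP y)); split.
- by move=> x; apply: fI; rewrite !f_iinv.
- by move=> y; apply: hI; rewrite !f_iinv.
- by move=> x; rewrite f_iinv.
Qed.

Lemma local_ok_sub a i r m n (f : 'I_m -> 'I_r) (h : 'I_n -> 'I_r) G Z A :
  injective f -> injective h -> (forall k, (k \in codom f) = (k \in codom h)) ->
  local_ok a i (mxsub h h G) (mxsub h h Z) (mxsub h h A) ->
  local_ok a i (mxsub f f G) (mxsub f f Z) (mxsub f f A).
Proof.
move=> fI hI /(same_image_bij fI hI) [e [e' [eK e'K he]]].
have E (M : 'M[Zp]_r) : mxsub f f M = mxsub e e (mxsub h h M).
  by apply/matrixP => x y; rewrite !mxE !he.
by rewrite !E; apply: local_ok_bij eK e'K.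
Qed.

End Reindexing.

Section Entries.
Variables (p : nat) (pp : prime p).
Local Notation Zp := (padic pp).
Variables (r : nat) (lev : 'I_r -> nat).

Lemma codom_block i k :
  (k \in codom (@enum_val _ [pred k | lev k == i])) = (lev k == i).
Proof.
apply/codomP/idP => [[x ->]|ki]; first exact: (enum_valP x).
have ki' : k \in [pred k | lev k == i] by [].
by exists (enum_rank_in ki' k); rewrite enum_rankK_in.
Qed.

(** Every entry of the matrix lies in exactly one block, so a property of entries
    that depends on the block indices may be checked on the matrix itself. *)
Lemma blockP (Q : nat -> nat -> Zp -> Prop) (M : 'M[Zp]_r) :
  (forall i j x y, Q i j (block lev M i j x y)) <->
  (forall k l, Q (lev k) (lev l) (M k l)).
Proof.
split=> [hM k l|hM i j x y].
  have /codomP [x ek] : k \in codom (@enum_val _ [pred z | lev z == lev k]).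
    by rewrite codom_block.
  have /codomP [y el] : l \in codom (@enum_val _ [pred z | lev z == lev l]).
    by rewrite codom_block.
  by have := hM _ _ x y; rewrite mxE -ek -el.
rewrite mxE; have := hM (enum_val x) (enum_val y).
by rewrite (eqP (enum_valP x)) (eqP (enum_valP y)).
Qed.

Lemma diag_blockP (Q : nat -> Zp -> Prop) (M : 'M[Zp]_r) :
  (forall i x, Q i (block lev M i i x x)) <-> (forall k, Q (lev k) (M k k)).
Proof.
split=> [hM k|hM i x].
  have /codomP [x ek] : k \in codom (@enum_val _ [pred z | lev z == lev k]).
    by rewrite codom_block.
  by have := hM _ x; rewrite mxE -ek.
by rewrite mxE; have := hM (enum_val x); rewrite (eqP (enum_valP x)).
Qed.

(** Conditions (i) and (ii) on the error A, at precision a. *)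
Definition small_error a (A : 'M[Zp]_r) : Prop :=
  mxdiv (fun k l => a + maxn (lev k) (lev l))%N A /\
  (p = 2%N -> forall k, zero_mod (p ^ (a + lev k + 1)) (A k k)).

Lemma approximateP a (F G Z : 'M[Zp]_r) :
  approximate lev a F G Z <->
  [/\ [/\ G^T = G, Z^T = Z & forall k l, lev k != lev l -> G k l = 0],
      F \in unitmx /\ mxdiv (fun k l => lev k - lev l)%N F,
      small_error a (F *m G *m F^T - Z)
    & forall i, local_ok a i (block lev G i i) (block lev Z i i)
                  (block lev (F *m G *m F^T - Z) i i)].
Proof.
split=> [[sG dG mG [uF cF] sZ eA dA oA]|[[sG sZ dG] [uF cF] [eA dA] loc]].
  split=> //.
  - split=> //; apply/(blockP (fun i j x => i != j -> x = 0)) => i j x y /dG ->.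
    by rewrite mxE.
  - by split=> //; apply/(blockP (fun i j x => zero_mod (p ^ (i - j)) x)).
  - split; first by apply/(blockP (fun i j x => zero_mod (p ^ (a + maxn i j)) x)).
    move=> p2; apply/(diag_blockP (fun i x => zero_mod (p ^ (a + i + 1)) x)) => i x.
    by have := dA p2 i x; rewrite -p2.
  - by move=> i; split=> // p2 a1 v; apply: oA.
split=> //.
- move=> i j ij; apply/matrixP => x y; rewrite [RHS]mxE.
  by move: i j x y ij; apply/(blockP (fun i j x => i != j -> x = 0)).
- by move=> i; case: (loc i).
- by split=> //; apply/(blockP (fun i j x => zero_mod (p ^ (i - j)) x)).
- by apply/(blockP (fun i j x => zero_mod (p ^ (a + maxn i j)) x)).
- move=> p2; rewrite -p2; apply/(diag_blockP (fun i x => zero_mod (p ^ (a + i + 1)) x)).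
  exact: dA.
- by move=> p2 a1 i v; case: (loc i) => _; apply.
Qed.

End Entries.

(** * Transport of the conditions on a diagonal block *)

Section LocalConditions.
Variables (p : nat) (pp : prime p).
Local Notation Zp := (padic pp).

Lemma tr_inj_scale i k (S : 'M[Zp]_k) :
  ((p ^ i)%:R *: S)^T = (p ^ i)%:R *: S -> S^T = S.
Proof. by rewrite linearZ => /scalemx_natXI. Qed.

Lemma expn_two (p2 : p = 2%N) n : (p ^ n = 2 ^ n)%N.
Proof. by rewrite p2. Qed.

(** A change of the matrix by a multiple of 2^(i+1) changes its unimodular part
    by a multiple of 2, which affects neither invertibility nor the congruences
    modulo 2 that define an oddity vector. *)
Lemma oddity_congr i k (M N : 'M[Zp]_k) v : p = 2%N -> N^T = N ->
  mxdiv (fun _ _ => i.+1) (M - N) -> oddity i M v -> oddity i N v.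
Proof.
move=> p2 sN /mx_zero_modP [Y eY] [S [[sS uS] eM oS]].
have eN : N = (2 ^ i)%:R *: (S - 2%:R *: Y).
  rewrite scalerBr -eM scalerA -natrM -expnSr -(expn_two p2) -eY opprB.
  by apply/matrixP => x y; rewrite !mxE; ring.
exists (S - 2%:R *: Y); split; [split | exact: eN |].
- by apply: (@tr_inj_scale i); rewrite (expn_two p2) -eN.
- rewrite -(@unitmx_congr _ _ _ S) // opprB addrC subrK => x y.
  by rewrite mxE -p2; exists (Y x y).
- move=> x x0 y0.
  have -> : v *m (S - 2%:R *: Y) *m x^T - x *m (S - 2%:R *: Y) *m x^T =
            (v *m S *m x^T - x *m S *m x^T) - 2%:R *: ((v - x) *m Y *m x^T).
    rewrite !(mulmxBl, mulmxBr) -!scalemxAr -!scalemxAl scalerBr.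
    by apply/matrixP => ? ?; rewrite !mxE; ring.
  rewrite mxE; apply: zero_modD (oS x x0 y0) _.
  by rewrite mxE; apply: zero_modN; rewrite mxE; exists (((v - x) *m Y *m x^T) x0 y0).
Qed.

Lemma oddity_scale i k (M : 'M[Zp]_k) v : p = 2%N ->
  oddity i ((p ^ i)%:R *: M) v <-> oddity 0 M v.
Proof.
move=> p2; split=> [[S [uS eS oS]]|[S [uS -> oS]]]; exists S; split=> //.
  by rewrite expn0 scale1r; apply: (@scalemx_natXI _ pp i); rewrite eS (expn_two p2).
by rewrite expn0 scale1r (expn_two p2).
Qed.

Lemma local_ok_congr a i k (G Z Z' A : 'M[Zp]_k) : Z^T = Z ->
  mxdiv (fun _ _ => i.+1) (Z' - Z) -> local_ok a i G Z A -> local_ok a i G Z' A.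
Proof.
move=> sZ dZ [mG oZ]; split=> // p2 a1 v oZ'.
by apply: oZ => //; apply: oddity_congr oZ'.
Qed.

Lemma local_ok_scale a i k (G Z A : 'M[Zp]_k) :
  local_ok a i ((p ^ i)%:R *: G) ((p ^ i)%:R *: Z) ((p ^ i)%:R *: A) <->
  local_ok a 0 G Z A.
Proof.
have E (v : 'rV[Zp]_k) :
    v *m ((p ^ i)%:R *: A) *m v^T = (p ^ i)%:R *: (v *m A *m v^T).
  by rewrite -scalemxAr -scalemxAl.
split=> [[mG oA]|[mG oA]]; split.
- case: mG => S uS eS; exists S => //.
  by rewrite expn0 scale1r; apply: scalemx_natXI eS.
- move=> p2 a1 v oZ.
  have := oA p2 a1 v; rewrite oddity_scale // E => /(_ oZ) h.
  have h' : mxdiv (fun _ _ => i + 3)%N ((p ^ i)%:R *: (v *m A *m v^T)).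
    by move=> x y; rewrite (expn_two p2 (_ + _)).
  by move=> x y; have := mxdiv_cancel h' x y; rewrite (expn_two p2).
- by case: mG => S uS ->; exists S => //; rewrite expn0 scale1r.
- move=> p2 a1 v; rewrite oddity_scale // E => /(oA p2 a1) h.
  have h' : mxdiv (fun _ _ => 3)%N (v *m A *m v^T).
    by move=> x y; rewrite (expn_two p2); apply: h.
  by move=> x y; have := mxdiv_scale i h' x y; rewrite (expn_two p2 (_ + _)).
Qed.

Lemma local_ok_empty a i k (G Z A : 'M[Zp]_k) : k = 0%N -> local_ok a i G Z A.
Proof.
move=> k0; subst k; split; last first.
  by move=> _ _ v _; rewrite [v]thinmx0 !mul0mx => x y; rewrite mxE; apply: zero_mod0.
exists 0; last by rewrite [G]flatmx0 scaler0.
by split; [rewrite trmx0 | rewrite unitmxE det_mx00 unitr1].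
Qed.

Lemma block_empty r (lev : 'I_r -> nat) i :
  (forall k, lev k != i) -> #|[pred k | lev k == i]| = 0%N.
Proof. by move=> h; apply: eq_card0 => k; apply/negbTE; apply: h. Qed.

(** With a single block of index 0 all conditions bear on the whole matrices. *)
Lemma approximate_const a k (F G Z : 'M[Zp]_k) :
  approximate (fun=> 0%N) a F G Z <->
  [/\ [/\ G^T = G, Z^T = Z & F \in unitmx],
      small_error (fun=> 0%N) a (F *m G *m F^T - Z)
    & local_ok a 0 G Z (F *m G *m F^T - Z)].
Proof.
have loc : local_ok a 0 G Z (F *m G *m F^T - Z) <->
    local_ok a 0 (block (fun=> 0%N) G 0 0) (block (fun=> 0%N) Z 0 0)
      (block (fun=> 0%N) (F *m G *m F^T - Z) 0 0).
  rewrite /block -[X in local_ok _ _ X]mxsub_id -[X in local_ok _ _ _ X]mxsub_id.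
  rewrite -[X in local_ok _ _ _ _ X]mxsub_id.
  have im k0 : (k0 \in codom (@enum_val _ [pred z : 'I_k | 0%N == 0%N])) =
               (k0 \in codom id).
    by rewrite (codom_block (fun=> 0%N)) eqxx; apply/esym/codomP; exists k0.
  by split; apply: local_ok_sub => //; try exact: enum_val_inj; move=> ?; rewrite -im.
rewrite approximateP; split=> [[[sG sZ _] [uF _] eA /(_ 0%N) /loc lA]|].
  by split.
move=> [[sG sZ uF] eA lA]; split=> //; first by split=> //; exact: mxdiv0.
case=> [|i]; first exact/loc.
by apply: local_ok_empty; apply: block_empty.
Qed.

End LocalConditions.

(** * Splitting off the first block *)

Section Split.
Variables (p : nat) (pp : prime p).
Local Notation Zp := (padic pp).
Variables (m n i : nat) (lev : 'I_(m + n) -> nat) (L : 'I_n -> nat).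
Hypothesis lev_l : forall k, lev (lshift n k) = i.
Hypothesis lev_r : forall k, lev (rshift m k) = L k.
Hypothesis iL : forall k, (i < L k)%N.

(** The block of index i is the upper left corner. *)
Lemma local_ok_ul a (G Z A : 'M[Zp]_(m + n)) :
  local_ok a i (block lev G i i) (block lev Z i i) (block lev A i i) <->
  local_ok a i (ulsubmx G) (ulsubmx Z) (ulsubmx A).
Proof.
have E (M : 'M[Zp]_(m + n)) : ulsubmx M = mxsub (@lshift m n) (@lshift m n) M.
  by apply/matrixP => x y; rewrite !mxE.
have im k : (k \in codom (@enum_val _ [pred z | lev z == i])) =
            (k \in codom (@lshift m n)).
  rewrite codom_block; apply/idP/codomP => [|[x ->]]; last by rewrite lev_l.
  case: (split_ordP k) => x ->; first by exists x.
  by rewrite lev_r gtn_eqF.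
rewrite !E; split; apply: local_ok_sub;
  solve [exact: enum_val_inj | exact: lshift_inj | by move=> ?; rewrite im].
Qed.

(** Every other block lies in the lower right corner. *)
Lemma local_ok_dr a j (G Z A : 'M[Zp]_(m + n)) : j != i ->
  local_ok a j (block lev G j j) (block lev Z j j) (block lev A j j) <->
  local_ok a j (block L (drsubmx G) j j) (block L (drsubmx Z) j j)
    (block L (drsubmx A) j j).
Proof.
move=> ji; pose f := @rshift m n \o @enum_val _ [pred z | L z == j].
have E (M : 'M[Zp]_(m + n)) : block L (drsubmx M) j j = mxsub f f M.
  by apply/matrixP => x y; rewrite !mxE.
have fI : injective f by move=> x y /rshift_inj /enum_val_inj.
have im k : (k \in codom (@enum_val _ [pred z | lev z == j])) = (k \in codom f).
  rewrite codom_block; apply/idP/codomP => [|[x ->]]; last first.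
    by rewrite lev_r; apply: (enum_valP x).
  case: (split_ordP k) => x ->; first by rewrite lev_l eq_sym (negbTE ji).
  rewrite lev_r -(codom_block L) => /codomP [y ->].
  by exists y.
rewrite !E; split; apply: local_ok_sub;
  solve [exact: enum_val_inj | exact: fI | by move=> ?; rewrite im].
Qed.

(** The max of two block indices is i in the upper left corner and the index of
    the row in the lower left one, because i is the smallest index. *)
Lemma small_error_block a (A1 : 'M[Zp]_m) (R : 'M[Zp]_(n, m)) (A2 : 'M[Zp]_n) :
  small_error lev a (block_mx ((p ^ i)%:R *: A1) R^T R A2) <->
  [/\ small_error (fun=> 0%N) a A1, mxdiv (fun k _ => a + L k)%N R
    & small_error L a A2].
Proof.
split=> [[dA eA]|[[d1 e1] dR [d2 e2]]].
  split; first split.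
  - apply: (@mxdiv_cancel _ _ i) => x y.
    have := dA (lshift n x) (lshift n y).
    by rewrite block_mxEul !lev_l maxnn maxn0 addn0 addnC.
  - move=> p2 k; have := eA p2 (lshift n k); rewrite block_mxEul lev_l mxE addn0.
    by rewrite addnAC addnC => /zero_mod_cancel.
  - move=> x y; have := dA (rshift m x) (lshift n y).
    by rewrite block_mxEdl lev_l lev_r (maxn_idPl (ltnW (iL x))).
  - split=> [x y|p2 k].
      by have := dA (rshift m x) (rshift m y); rewrite block_mxEdr !lev_r.
    by have := eA p2 (rshift m k); rewrite block_mxEdr !lev_r.
split=> [x y|p2 k].
  case: (split_ordP x) => x' ->; case: (split_ordP y) => y' ->.
  - rewrite block_mxEul !lev_l maxnn addnC -[a]addn0.
    by have := mxdiv_scale i d1 x' y'; rewrite maxn0.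
  - by rewrite block_mxEur lev_l lev_r mxE (maxn_idPr (ltnW (iL y'))); apply: dR.
  - by rewrite block_mxEdl lev_l lev_r (maxn_idPl (ltnW (iL x'))); apply: dR.
  - by rewrite block_mxEdr !lev_r; apply: d2.
case: (split_ordP k) => x ->; last by rewrite block_mxEdr !lev_r; apply: e2.
rewrite block_mxEul lev_l mxE addnAC addnC expnD; have := e1 p2 x; rewrite addn0.
by apply: zero_modM; apply: zero_mod_nat.
Qed.

(** The block F21 vanishes modulo p, so F is block triangular modulo p. *)
Lemma unitmx_block F11 F12 (F21 : 'M[Zp]_(n, m)) F22 :
  mxdiv (fun k _ => L k - i)%N F21 ->
  (block_mx F11 F12 F21 F22 \in unitmx) = (F11 \in unitmx) && (F22 \in unitmx).
Proof.
move=> dF; rewrite (@unitmx_congr _ _ _ _ (block_mx F11 F12 0 F22)).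
  by rewrite !unitmxE det_ublock unitrM.
rewrite opp_block_mx add_block_mx !subrr oppr0 addr0 => x y.
case: (split_ordP x) => x' ->; case: (split_ordP y) => y' ->;
  rewrite (block_mxEul, block_mxEur, block_mxEdl, block_mxEdr);
  try by rewrite mxE; apply: zero_mod0.
rewrite -[p in zero_mod p]expn1; apply: zero_mod_exp (dF x' y').
by have := iL x'; lia.
Qed.

Lemma approximate_rows r (l : 'I_r -> nat) a (F G Z : 'M[Zp]_r) :
  approximate l a F G Z -> mxdiv (fun k _ => l k) G.
Proof.
move=> ap; apply/(blockP l (fun i _ x => zero_mod (p ^ i) x)) => j j' x y.
case: (eqVneq j j') y => [<- y|ne y]; last first.
  by rewrite (approx_diag ap ne) mxE; apply: zero_mod0.
by have [S _ ->] := approx_modular ap j; rewrite mxE; exists (S x y).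
Qed.

(** The error of the full triple has as diagonal corners p^i times the error of
    the first triple and the error of the second one, with the products
    F12 G2 F12^T and F21 G1 F21^T moved to the target. These products are
    divisible by one power of p more than the block index, so moving them does
    not change the oddity vectors of the diagonal blocks of the target. *)
Lemma approximate_split a (F11 : 'M[Zp]_m) F12 F21 (F22 : 'M[Zp]_n) G1 G2 Z1 Z21 Z22 :
  approximate lev a (block_mx F11 F12 F21 F22)
    (block_mx ((p ^ i)%:R *: G1) 0 0 G2)
    (block_mx ((p ^ i)%:R *: Z1 + F12 *m G2 *m F12^T) Z21^T Z21 Z22) <->
  [/\ approximate (fun=> 0%N) a F11 G1 Z1,
      approximate L a F22 G2 (Z22 - F21 *m ((p ^ i)%:R *: G1) *m F21^T),
      mxdiv (fun k _ => L k - i)%N F21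
    & mxdiv (fun k _ => a + L k)%N
        (F21 *m ((p ^ i)%:R *: G1) *m F11^T + F22 *m G2 *m F12^T - Z21)].
Proof.
set F := block_mx F11 F12 F21 F22; set G := block_mx _ 0 0 G2.
set Z := block_mx (_ + _) _ _ _; set Z2 := Z22 - _; set R := _ - Z21.
pose A1 := F11 *m G1 *m F11^T - Z1; pose A2 := F22 *m G2 *m F22^T - Z2.
have symG1 : G1^T = G1 -> ((p ^ i)%:R *: G1)^T = (p ^ i)%:R *: G1.
  by move=> sG1; rewrite linearZ /= sG1.
have errE : G1^T = G1 -> G2^T = G2 ->
    F *m G *m F^T - Z = block_mx ((p ^ i)%:R *: A1) R^T R A2.
  move=> sG1 sG2; rewrite /F /G /Z tr_block_mx !mulmx_block !mulmx0 !addr0 !add0r.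
  rewrite opp_block_mx add_block_mx; congr block_mx.
  - rewrite /A1 scalerBr -scalemxAr -scalemxAl.
    by apply/matrixP => x y; rewrite !mxE; ring.
  - have trR (X Y T : 'M[Zp]_(n, m)) : (X + Y - T)^T = X^T + Y^T - T^T.
      by apply/matrixP => x y; rewrite !mxE.
    by rewrite /R trR !trmx_mul !trmxK (symG1 sG1) sG2 !mulmxA.
  - by rewrite /A2 /Z2; apply/matrixP => x y; rewrite !mxE; ring.
have symW : G2^T = G2 -> (F12 *m G2 *m F12^T)^T = F12 *m G2 *m F12^T.
  by move=> sG2; rewrite !trmx_mul trmxK sG2 mulmxA.
have symD : G1^T = G1 -> (F21 *m ((p ^ i)%:R *: G1) *m F21^T)^T =
    F21 *m ((p ^ i)%:R *: G1) *m F21^T.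
  by move=> sG1; rewrite !trmx_mul trmxK symG1 // mulmxA.
have divW : mxdiv (fun k _ => L k) G2 ->
    mxdiv (fun _ _ => i.+1) (F12 *m G2 *m F12^T).
  move=> dG2; apply: (mxdivM (f := fun _ _ => i.+1) (g := fun _ _ => 0%N)).
  - by move=> *; rewrite addn0.
  - apply: (mxdivM (f := fun _ _ => 0%N)) (mxdiv0 _) dG2.
    by move=> *; apply: iL.
  - exact: mxdiv0.
have divD : mxdiv (fun k _ => L k - i)%N F21 ->
    mxdiv (fun k _ => (L k).+1) (F21 *m ((p ^ i)%:R *: G1) *m F21^T).
  move=> dF; have dFG : mxdiv (fun k _ => L k)%N (F21 *m ((p ^ i)%:R *: G1)).
    apply: (mxdivM _ dF (mxdiv_scale i (mxdiv0 G1))) => x z y.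
    by have := iL x; lia.
  apply: (mxdivM _ dFG (mxdiv_tr dF)) => x z y.
  by have := iL y; lia.
have locW : Z1^T = Z1 -> G2^T = G2 -> mxdiv (fun k _ => L k) G2 ->
    local_ok a i ((p ^ i)%:R *: G1) ((p ^ i)%:R *: Z1 + F12 *m G2 *m F12^T)
      ((p ^ i)%:R *: A1) <-> local_ok a 0 G1 Z1 A1.
  move=> sZ1 sG2 dG2; rewrite -(local_ok_scale a i G1 Z1 A1).
  split; apply: local_ok_congr.
  - by rewrite linearD /= linearZ /= sZ1 symW.
  - by rewrite opprD addrA subrr add0r; apply/mxdivN/divW.
  - by rewrite linearZ /= sZ1.
  - by rewrite addrC addKr; apply: divW.
have divDj j : mxdiv (fun k _ => L k - i)%N F21 ->
    mxdiv (fun _ _ => j.+1)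
      (block L (F21 *m ((p ^ i)%:R *: G1) *m F21^T) j j).
  move=> /divD dD.
  exact: ((blockP L (fun i _ x => zero_mod (p ^ i.+1) x) _).2 dD j j).
have locD j : G1^T = G1 -> Z22^T = Z22 -> mxdiv (fun k _ => L k - i)%N F21 ->
    local_ok a j (block L G2 j j) (block L Z22 j j) (block L A2 j j) <->
    local_ok a j (block L G2 j j) (block L Z2 j j) (block L A2 j j).
  move=> sG1 sZ22 dF; split; apply: local_ok_congr.
  - by rewrite /block trmx_mxsub sZ22.
  - rewrite /Z2 /block linearB /= addrC addKr; exact/mxdivN/divDj.
  - by rewrite /block trmx_mxsub /Z2 linearB /= sZ22 symD.
  - by rewrite /Z2 /block linearB /= opprB addrC subrK; apply: divDj.
split=> [ap|[/approximate_const [[sG1 sZ1 uF11] e1 l1] ap2 dF21 dR]].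
  have [[sG sZ dG] [uF dF] eA lA] := (approximateP _ _ _ _ _).1 ap.
  have [/tr_inj_scale sG1 _ _ sG2] : [/\ ((p ^ i)%:R *: G1)^T = (p ^ i)%:R *: G1,
      0^T = 0 :> 'M[Zp]_(m, n), 0^T = 0 :> 'M[Zp]_(n, m) & G2^T = G2].
    by move: sG; rewrite /G tr_block_mx => /eq_block_mx [].
  have [sZ1' _ _ sZ22] : [/\ ((p ^ i)%:R *: Z1 + F12 *m G2 *m F12^T)^T =
      (p ^ i)%:R *: Z1 + F12 *m G2 *m F12^T, Z21^T = Z21^T, Z21^T^T = Z21
      & Z22^T = Z22].
    by move: sZ; rewrite /Z tr_block_mx => /eq_block_mx [].
  have sZ1 : Z1^T = Z1.
    by move: sZ1'; rewrite linearD /= symW // => /addIr; apply: tr_inj_scale.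
  have dF21 : mxdiv (fun k _ => L k - i)%N F21.
    move=> x y; have := dF (rshift m x) (lshift n y).
    by rewrite block_mxEdl lev_l lev_r.
  have dG2 : mxdiv (fun k _ => L k) G2.
    move=> x y; have := approximate_rows ap (rshift m x) (rshift m y).
    by rewrite block_mxEdr lev_r.
  move: uF; rewrite unitmx_block // => /andP [uF11 uF22].
  move: eA lA; rewrite errE // => /small_error_block [e1 dR e2] lA.
  split=> //.
    apply/approximate_const; split=> //; apply/locW => //.
    by move/local_ok_ul: (lA i); rewrite !block_mxKul.
  apply/approximateP; split=> //.
  - split=> //; first by rewrite linearB /= sZ22 symD.
    move=> k l kl; have := dG (rshift m k) (rshift m l).
    by rewrite block_mxEdr !lev_r => /(_ kl).
  - split=> // x y; have := dF (rshift m x) (rshift m y).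
    by rewrite block_mxEdr !lev_r.
  - move=> j; have [<-|ji] := eqVneq i j.
      by apply: local_ok_empty; apply: block_empty => k; rewrite gtn_eqF.
    apply/locD => //; move: (lA j); rewrite local_ok_dr 1?eq_sym //.
    by rewrite !block_mxKdr.
have dG2 := approximate_rows ap2.
move/approximateP: ap2 => [[sG2 sZ2 dG] [uF22 dF22] e2 l2].
have sZ22 : Z22^T = Z22.
  by move: sZ2; rewrite /Z2 linearB /= symD // => /addIr.
apply/approximateP; rewrite errE //; split.
- split.
  + by rewrite /G tr_block_mx linearZ /= sG1 sG2 !trmx0.
  + by rewrite /Z tr_block_mx linearD /= linearZ /= sZ1 symW // trmxK sZ22.
  + move=> x y; case: (split_ordP x) => x' ->; case: (split_ordP y) => y' ->;
      rewrite ?lev_l ?lev_r ?eqxx //.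
    * by rewrite block_mxEur mxE.
    * by rewrite block_mxEdl mxE.
    * by rewrite block_mxEdr; apply: dG.
- split; first by rewrite unitmx_block // uF11.
  move=> x y; case: (split_ordP x) => x' ->; case: (split_ordP y) => y' ->;
    rewrite ?lev_l ?lev_r.
  + by rewrite subnn; apply: zero_mod1.
  + by rewrite (_ : (i - _)%N = 0%N); [apply: zero_mod1 | have := iL y'; lia].
  + by rewrite block_mxEdl; apply: dF21.
  + by rewrite block_mxEdr; apply: dF22.
- exact/small_error_block.
- move=> j; have [<-|ji] := eqVneq i j.
    by apply/local_ok_ul; rewrite !block_mxKul; apply/locW.
  rewrite local_ok_dr 1?eq_sym // !block_mxKdr; exact/locD.
Qed.

(** Every approximate triple has the shape assumed in [approximate_split]: the
    exact divisions by p^i in the procedure are possible because G1 is divisible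
    by p^i and the upper left corner of the error is too. *)
Lemma approximate_blocks a (F G Z : 'M[Zp]_(m + n)) :
  approximate lev a F G Z ->
  exists G1 Z1, [/\ ulsubmx G = (p ^ i)%:R *: G1,
    ulsubmx Z - ursubmx F *m drsubmx G *m (ursubmx F)^T = (p ^ i)%:R *: Z1,
    G = block_mx ((p ^ i)%:R *: G1) 0 0 (drsubmx G)
  & Z = block_mx ((p ^ i)%:R *: Z1 + ursubmx F *m drsubmx G *m (ursubmx F)^T)
          (dlsubmx Z)^T (dlsubmx Z) (drsubmx Z)].
Proof.
move=> ap; have dG := approximate_rows ap.
have [[sG sZ zG] [uF dF] [eA _] lA] := (approximateP _ _ _ _ _).1 ap.
have G12 : ursubmx G = 0.
  apply/matrixP => x y; rewrite !mxE; apply: zG.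
  by rewrite lev_l lev_r ltn_eqF.
have G21 : dlsubmx G = 0 by rewrite -[G]sG -trmx_ursub G12 trmx0.
have [G1 eG1] : exists G1, ulsubmx G = (p ^ i)%:R *: G1.
  apply: mx_zero_modP => x y; rewrite mxE mxE.
  by have := dG (lshift n x) (lshift n y); rewrite lev_l.
have [Z1 eZ1] : exists Z1, ulsubmx Z - ursubmx F *m drsubmx G *m (ursubmx F)^T =
    (p ^ i)%:R *: Z1.
  apply: mx_zero_modP.
  have -> : ulsubmx Z - ursubmx F *m drsubmx G *m (ursubmx F)^T =
      (p ^ i)%:R *: (ulsubmx F *m G1 *m (ulsubmx F)^T)
      - ulsubmx (F *m G *m F^T - Z).
    rewrite -[in RHS](submxK F) -[in RHS](submxK G) G12 G21 eG1 tr_block_mx.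
    rewrite !mulmx_block !mulmx0 !addr0 !add0r !block_mxKul.
    have -> X Y : ulsubmx (X - Y : 'M[Zp]_(m + n)) = ulsubmx X - ulsubmx Y.
      by apply/matrixP => x y; rewrite !mxE.
    rewrite block_mxKul.
    by rewrite -scalemxAr -scalemxAl; apply/matrixP => x y; rewrite !mxE; ring.
  move=> x y; rewrite mxE; apply: zero_modD.
    by rewrite mxE; exists ((ulsubmx F *m G1 *m (ulsubmx F)^T) x y).
  rewrite mxE; apply: zero_modN; have := eA (lshift n x) (lshift n y).
  rewrite !lev_l maxnn [ulsubmx]lock !mxE -lock => /(zero_mod_exp (leq_addl _ _)).
  by rewrite !mxE.
exists G1, Z1; split=> //.
  by rewrite -eG1 -{1}[G]submxK G12 G21.
by rewrite -eZ1 subrK trmx_dlsub sZ submxK.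
Qed.

End Split.

(** * Symmetric matrices, in general and over the field with two elements *)

Section SymmetricForms.
Variable R : comNzRingType.

Definition upper_part n (A : 'M[R]_n) : 'M[R]_n :=
  \matrix_(k, l) if (k < l)%N then A k l else 0.

Lemma symmetric_decomposition n (A : 'M[R]_n) : A^T = A ->
  A = upper_part A + (upper_part A)^T + diag_mx (\row_k A k k).
Proof.
move=> /matrixP sA; apply/matrixP => k l; rewrite !mxE.
have := sA k l; rewrite mxE => sAkl; case: (ltngtP k l) => kl.
- by rewrite (negbTE (_ : k != l)) ?addr0 // neq_ltn kl.
- by rewrite (negbTE (_ : k != l)) ?addr0 ?add0r // neq_ltn kl orbT.
- by rewrite (val_inj kl) eqxx !add0r.
Qed.

(** Off-diagonal entries of a symmetric matrix contribute twice to its quadratic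
    form; modulo 2 only the diagonal is seen. *)
Lemma symmetric_form n (A : 'M[R]_n) (v : 'rV_n) : A^T = A ->
  (v *m A *m v^T) 0 0 =
  2%:R * (v *m upper_part A *m v^T) 0 0 + \sum_k v 0 k * v 0 k * A k k.
Proof.
move=> sA; rewrite {1}(symmetric_decomposition sA) !mulmxDr !mulmxDl.
have -> : v *m (upper_part A)^T *m v^T = (v *m upper_part A *m v^T)^T.
  by rewrite !trmx_mul !trmxK mulmxA.
rewrite [LHS]mxE [X in X + _]mxE [(_^T) 0 0]mxE; congr (_ + _); first by ring.
rewrite mul_mx_diag mxE; apply: eq_bigr => k _; rewrite !mxE; ring.
Qed.

End SymmetricForms.

Section IdempotentField.
Variables (K : fieldType).
Hypothesis idem : forall x : K, x * x = x.

Lemma idem_add (x : K) : x + x = 0.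
Proof.
have: (1 + 1) * (1 + 1) = 1 + 1 :> K by rewrite idem.
rewrite mulrDl !mul1r -[RHS]addr0 => /addrI e.
by rewrite -[x]mul1r -mulrDl e mul0r.
Qed.

(** The map sending a symmetric Y to diag(Y) + Y w has image w^perp. When some
    w m = 1, a solution is supported on row and column m: entry (k, m) settles
    equation k for k != m, and equation m then holds since w is orthogonal
    to c. *)
Lemma symmetric_solution n (w c : 'I_n -> K) : \sum_k w k * c k = 0 ->
  exists Y : 'M[K]_n, Y^T = Y /\ forall k, Y k k + \sum_l Y k l * w l = c k.
Proof.
move=> wc0; have [[m wm]|w0] := pselect (exists m, w m != 0); last first.
  exists (diag_mx (\row_k c k)); split; first exact: tr_diag_mx.
  move=> k; rewrite !mxE eqxx big1 ?addr0 // => l _.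
  have [->|] := eqVneq (w l) 0; first by rewrite mulr0.
  by move=> wl; case: w0; exists l.
have w1 : w m = 1 by apply: (mulfI wm); rewrite idem mulr1.
exists (\matrix_(k, l) if k == m then if l == m then 0 else c l
                       else if l == m then c k else 0); split.
  by apply/matrixP => k l; rewrite !mxE; case: eqP; case: eqP.
move=> k; rewrite !mxE; case: eqVneq => [->|km].
  rewrite add0r; apply: (addrI (c m)); rewrite idem_add -[RHS]wc0.
  rewrite [in RHS](bigD1 m) //= (bigD1 m) //= w1 mul1r !mxE !eqxx mul0r add0r.
  congr (_ + _); apply: eq_bigr => l lm.
  by rewrite !mxE eqxx (negbTE lm) mulrC.
rewrite (bigD1 m) //= big1 => [|l lm].
  by rewrite !mxE (negbTE km) eqxx w1 mulr1 addr0 add0r.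
by rewrite !mxE (negbTE km) (negbTE lm) mul0r.
Qed.

End IdempotentField.

Lemma Fp_idem p (x : 'F_p) : p = 2%N -> x * x = x.
Proof.
move=> p2; subst p; case: x => [[|[|k]] hk] //; exact: val_inj.
Qed.

(** * Precision of an approximate triple *)

Section Approximation.
Variables (p : nat) (pp : prime p).
Local Notation Zp := (padic pp).

Section Levels.
Variables (r : nat) (lev : 'I_r -> nat).
Implicit Types A F G Z : 'M[Zp]_r.

Lemma small_errorD a A B :
  small_error lev a A -> small_error lev a B -> small_error lev a (A + B).
Proof.
move=> [dA eA] [dB eB]; split; first exact: mxdivD.
by move=> p2 k; rewrite mxE; apply: zero_modD; [apply: eA | apply: eB].
Qed.

Lemma small_errorN a A : small_error lev a A -> small_error lev a (- A).
Proof.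
move=> [dA eA]; split; first exact: mxdivN.
by move=> p2 k; rewrite mxE; apply: zero_modN; apply: eA.
Qed.

Lemma small_error_div a A :
  mxdiv (fun k l => a + maxn (lev k) (lev l) + 1)%N A -> small_error lev a A.
Proof.
move=> dA; split; first by apply: mxdiv_le dA => k l; rewrite leq_addr.
by move=> p2 k; have := dA k k; rewrite maxnn.
Qed.

Lemma small_error_le a b A : (b <= a)%N -> small_error lev a A -> small_error lev b A.
Proof.
move=> ba [dA eA]; split; first by apply: mxdiv_le dA => k l; lia.
by move=> p2 k; apply: zero_mod_exp (eA p2 k); lia.
Qed.

Lemma compatible_congr a F F' : (1 <= a)%N ->
  mxdiv (fun k l => a + (lev k - lev l))%N (F' - F) ->
  F \in unitmx /\ mxdiv (fun k l => lev k - lev l)%N F ->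
  F' \in unitmx /\ mxdiv (fun k l => lev k - lev l)%N F'.
Proof.
move=> a1 dFF [uF dF]; split.
  rewrite (@unitmx_congr _ _ _ _ F) // => k l.
  by rewrite -[p in zero_mod p]expn1; apply: zero_mod_exp (dFF k l); lia.
rewrite -[F'](subrK F); apply: mxdivD dF.
by apply: mxdiv_le dFF => k l; lia.
Qed.

Lemma error_sym F G Z : G^T = G -> Z^T = Z ->
  (F *m G *m F^T - Z)^T = F *m G *m F^T - Z.
Proof.
by move=> sG sZ; rewrite linearB /= sZ !trmx_mul trmxK sG mulmxA.
Qed.

(** Only condition (iii) at the lower precision 1 needs an argument: at a higher
    precision a, the value of the error at any vector is divisible by
    2^(a + i + 1), since off-diagonal entries count twice. *)
Lemma approximate_le a b F G Z : (b <= a)%N ->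
  approximate lev a F G Z -> approximate lev b F G Z.
Proof.
move=> ba /approximateP [[sG sZ zG] cF eA lA]; apply/approximateP; split=> //.
  exact: small_error_le eA.
move=> i; have [mG oA] := lA i; split=> // p2 b1 v oZ.
have [a1|a2] := eqVneq a 1%N; first exact: oA.
set A := block _ _ _ _.
have sA : A^T = A by rewrite /A /block trmx_mxsub error_sym.
have dA : mxdiv (fun _ _ => a + i)%N A.
  case: eA => + _ => /(blockP lev (fun i j x => zero_mod (p ^ (a + maxn i j)) x)).
  by move=> h x y; have := h i i x y; rewrite maxnn.
have eAk k : zero_mod (p ^ (a + i + 1)) (A k k).
  case: eA => _ /(_ p2) => /(diag_blockP lev (fun i x => zero_mod (p ^ (a + i + 1)) x)).
  by apply.
move=> x y; rewrite !ord1 -(expn_two p2).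
have le3 : (i + 3 <= a + i + 1)%N by lia.
apply: zero_mod_exp le3 _; rewrite symmetric_form //; apply: zero_modD.
  rewrite addnC expnD expn1 -p2; apply: zero_modM (zero_mod_nat _ _) _.
  rewrite mxE; apply: zero_mod_sum => k _; rewrite mulrC; apply: zero_modMl.
  rewrite mxE; apply: zero_mod_sum => l _; apply: zero_modMl.
  by rewrite mxE; case: ifP => _; [apply: dA | apply: zero_mod0].
by apply: zero_mod_sum => k _; apply: zero_modMl.
Qed.

(** From precision 2 on condition (iii) is void, so only the size of the error
    matters when F and Z change. *)
Lemma approximate_of_error a0 a F F' G Z0 Z : (2 <= a)%N ->
  approximate lev a0 F G Z0 -> Z^T = Z ->
  F' \in unitmx /\ mxdiv (fun k l => lev k - lev l)%N F' ->
  small_error lev a (F' *m G *m F'^T - Z) -> approximate lev a F' G Z.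
Proof.
move=> a2 /approximateP [[sG _ zG] _ _ lA] sZ cF eA; apply/approximateP; split=> //.
move=> i; have [mG _] := lA i; split=> // _ a1; by move: a2; rewrite a1.
Qed.

End Levels.

(** Since G is symmetric, both linear terms E G F^T and F G E^T of the expansion
    are expressed by B. *)
Lemma newton_step n (F G Z B E : 'M[Zp]_n) : G^T = G ->
  E *m (G *m F^T) = B ->
  (F - E) *m G *m (F - E)^T - Z =
  (F *m G *m F^T - Z) - (B + B^T) + E *m G *m E^T.
Proof.
move=> sG <-; rewrite !trmx_mul trmxK sG linearB /= !(mulmxBl, mulmxBr) !mulmxA.
by apply/matrixP => x y; rewrite !mxE; ring.
Qed.

Lemma succeeds_rdiv k l (A X0 : 'M[Zp]_(k, l)) (B : 'M[Zp]_l) Q :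
  \det B != 0 -> X0 *m B = A -> (forall X, X *m B = A -> Q X) ->
  succeeds (rdiv_mx A B) Q.
Proof.
move=> dB eX0 hQ; apply: succeeds_bind; apply: succeeds_ensure => //.
by apply: succeeds_select => //; exists X0.
Qed.

Lemma succeeds_rdiv_unit k l (A : 'M[Zp]_(k, l)) (B : 'M[Zp]_l) Q :
  B \in unitmx -> Q (A *m invmx B) -> succeeds (rdiv_mx A B) Q.
Proof.
move=> uB hQ; apply: (@succeeds_rdiv _ _ _ (A *m invmx B)).
- by move: uB; rewrite unitmxE; apply: contraTneq => ->; rewrite unitr0.
- by rewrite mulmxKV.
- by move=> X eX; rewrite -[X](mulmxK uB) eX.
Qed.

End Approximation.

(** * The unimodular procedure *)

Section Unimodular.
Variables (p : nat) (pp : prime p).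
Local Notation Zp := (padic pp).

Lemma residue_idem (x : Zp) : p = 2%N -> residue x * residue x = residue x.
Proof. exact: Fp_idem. Qed.

Lemma residue_form n (V : 'M[Zp]_n) (x : 'rV_n) : p = 2%N -> V^T = V ->
  residue ((x *m V *m x^T) 0 0) = residue (\sum_l x 0 l * V l l).
Proof.
move=> p2 sV; rewrite symmetric_form // rmorphD rmorphM /=.
have -> : residue (2%:R : Zp) = 0 by apply/zero_modP; rewrite -p2; apply: zero_mod_nat.
rewrite mul0r add0r !rmorph_sum; apply: eq_bigr => l _ /=.
by rewrite !rmorphM residue_idem.
Qed.

(** With x Z = y, the value x Z x^T = y Z^-1 y^T is congruent modulo 2 to the sum
    of the y_l (Z^-1)_ll, which is the product of the diagonal of Z^-1 with
    Z x^T. *)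
Lemma oddity_inverse n (Z : 'M[Zp]_n) : p = 2%N -> Z^T = Z -> Z \in unitmx ->
  oddity 0 Z (\row_l invmx Z l l).
Proof.
move=> p2 sZ uZ; exists Z; split=> //; first by rewrite expn0 scale1r.
move=> x i j; rewrite !ord1 -p2; apply/zero_modP.
have sV : (invmx Z)^T = invmx Z by rewrite trmx_inv sZ.
set w := \row_l _.
have -> : x *m Z *m x^T = (x *m Z) *m invmx Z *m (x *m Z)^T.
  by rewrite mulmxK // trmx_mul sZ mulmxA.
rewrite mxE [X in _ + X]mxE rmorphB /= residue_form // -rmorphB.
have -> : w *m Z *m x^T = (x *m Z *m w^T)^T by rewrite !trmx_mul !trmxK sZ mulmxA.
rewrite mxE [X in X - _]mxE (_ : \sum_(k < n) _ = \sum_(l < n) (x *m Z) 0 l * invmx Z l l).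
  by rewrite subrr rmorph0.
by apply: eq_bigr => k _; rewrite [w^T _ _]mxE [w _ _]mxE.
Qed.

Lemma natr_residue (c : 'F_p) : residue ((c : nat)%:R : Zp) = c.
Proof. by rewrite rmorph_nat natr_Zp. Qed.

(** One looks for X = U + Y with U the strictly upper triangular part of A/2 and
    Y symmetric modulo 2: the first congruence then holds because the diagonal
    of A/2 is even, and the second one is a system for Y solved by
    [symmetric_solution]. Its right-hand side is orthogonal to w = diag(Z^-1)
    because the pairing is w A w^T divided by 4, which is even by
    condition (iii). *)
Lemma start_solvable n (Z A A2 : 'M[Zp]_n) (d : 'I_n -> Zp) :
  p = 2%N -> Z^T = Z -> Z \in unitmx -> A^T = A ->
  2%:R *: A2 = A -> (forall k, 4%:R * d k = A k k) ->
  (forall v, oddity 0 Z v -> mx_zero_mod (2 ^ 3) (v *m A *m v^T)) ->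
  exists X : 'M[Zp]_n, mx_zero_mod 2 (X + X^T - A2) /\
    forall k, zero_mod 2 (X k k + \sum_l X k l * invmx Z l l - d k).
Proof.
move=> p2 sZ uZ sA eA2 ed odd.
pose w : 'rV[Zp]_n := \row_l invmx Z l l; pose U := upper_part A2.
have n2 : (2%:R : Zp) != 0.
  by rewrite -p2; have := padic_natX_neq0 pp 1; rewrite expn1.
have sA2 : A2^T = A2.
  apply/matrixP => x y; apply: (mulfI n2); move/matrixP: sA => /(_ x y).
  by rewrite -eA2 !mxE.
have eUA : upper_part A = 2%:R *: U.
  by apply/matrixP => k l; rewrite -eA2 !mxE; case: ifP => _ //; rewrite mulr0.
(* One quarter of w A w^T, by [symmetric_form] and U = upper part of A/2. *)
pose T := \sum_k w 0 k * (\sum_l U k l * w 0 l) + \sum_k w 0 k * w 0 k * d k.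
have eT : (w *m A *m w^T) 0 0 = (p ^ 2)%:R * T.
  rewrite symmetric_form // eUA -scalemxAr -scalemxAl mxE mulrA -natrM.
  rewrite (expn_two p2) mulrDr; congr (_ * _ + _).
    rewrite -mulmxA mxE; apply: eq_bigr => k _; congr (_ * _).
    by rewrite mxE; apply: eq_bigr => l _; rewrite [w^T _ _]mxE.
  by rewrite mulr_sumr; apply: eq_bigr => k _; rewrite -ed mulrCA.
have T0 : residue T = 0.
  apply/zero_modP; rewrite -[p in zero_mod p]expn1; apply: (@zero_mod_cancel _ _ 2).
  by rewrite -eT (expn_two p2); apply: odd; apply: oddity_inverse.
(* The right-hand side c of the system for Y is d - U w; signs do not matter
   in characteristic 2. *)
pose rw k := residue (w 0 k).
pose c k := residue (d k) + \sum_l residue (U k l) * rw l.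
have wc0 : \sum_k rw k * c k = 0.
  rewrite -[RHS]T0 rmorphD /= !rmorph_sum /= -big_split /=; apply: eq_bigr => k _ /=.
  rewrite !rmorphM residue_idem // rmorph_sum /= mulrDr [LHS]addrC; congr (_ * _ + _).
  by apply: eq_bigr => l _; rewrite rmorphM.
have idem (x : 'F_p) : x * x = x by apply: Fp_idem.
have [Y [sY eY]] := symmetric_solution idem wc0.
exists (\matrix_(k, l) (U k l + (Y k l : nat)%:R)); split=> [k l|k].
  rewrite -p2; apply/zero_modP; rewrite !mxE.
  rewrite rmorphB !rmorphD /= !natr_residue.
  have -> : Y l k = Y k l by rewrite -[in LHS]sY mxE.
  rewrite addrACA idem_add // addr0 -rmorphD -rmorphB.
  apply/zero_modP.
  have /matrixP/(_ k l) := symmetric_decomposition sA2; rewrite !mxE => e.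
  rewrite [in X in _ - X]e opprD addrA subrr add0r; apply: zero_modN.
  case: eqP => _; last exact: zero_mod0.
  exists (d k); apply: (mulfI n2); rewrite mulr1n.
  have := ed k; rewrite -eA2 mxE => <-.
  by rewrite mulrA -natrM; congr (_%:R * _); rewrite p2.
rewrite -p2; apply/zero_modP; rewrite !mxE.
rewrite rmorphB !rmorphD /= natr_residue ltnn rmorph0 add0r.
have -> : residue (\sum_l (\matrix_(k, l) (U k l + (Y k l : nat)%:R)) k l * invmx Z l l)
  = \sum_l residue (U k l) * rw l + \sum_l Y k l * rw l.
  rewrite rmorph_sum -big_split; apply: eq_bigr => l _ /=.
  by rewrite /rw !mxE rmorphM rmorphD /= natr_residue mulrDl.
by rewrite addrCA eY /c [residue (d k) + _]addrC addrA idem_add // add0r subrr.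
Qed.

Lemma divn_two_div n a (D B : 'M[Zp]_n) : p = 2%N ->
  2%:R *: B = D -> mxdiv (fun _ _ => a.+1) D -> mxdiv (fun _ _ => a) B.
Proof.
move=> p2 eD dD; apply: (@mxdiv_cancel _ _ 1) => x y.
by rewrite expn1 [p in p%:R]p2 eD.
Qed.

Lemma mul_invmx_div n a (F G B : 'M[Zp]_n) :
  mxdiv (fun _ _ => a) B -> mxdiv (fun _ _ => a) (B *m invmx (G *m F^T)).
Proof. by move=> dB; apply: (mxdivM _ dB (mxdiv0 _)) => *; rewrite addn0. Qed.

Lemma form_div n a (E G : 'M[Zp]_n) :
  mxdiv (fun _ _ => a) E -> mxdiv (fun _ _ => 2 * a)%N (E *m G *m E^T).
Proof.
move=> dE; apply: (mxdivM (f := fun _ _ => a) _ _ (mxdiv_tr dE)).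
  by move=> *; lia.
by apply: (mxdivM _ dE (mxdiv0 G)) => *; rewrite addn0.
Qed.

Lemma unit_GF n (F G : 'M[Zp]_n) : unimodular G -> F \in unitmx ->
  G *m F^T \in unitmx.
Proof. by move=> [_ uG] uF; rewrite unitmx_mul uG unitmx_tr. Qed.

(** It remains for each variant of the iteration to bound the new error. *)
Lemma newton_update n a a' (F G Z B : 'M[Zp]_n) : (1 <= a)%N -> (2 <= a')%N ->
  unimodular G -> approximate (fun=> 0%N) a F G Z ->
  mxdiv (fun _ _ => a) B ->
  let E := B *m invmx (G *m F^T) in
  small_error (fun=> 0%N) a'
    ((F *m G *m F^T - Z) - (B + B^T) + E *m G *m E^T) ->
  mxdiv (fun _ _ => a) (F - E - F) /\ approximate (fun=> 0%N) a' (F - E) G Z.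
Proof.
move=> a1 a2 uG ap dB E eA.
have /approximateP [[sG sZ _] [uF cF] _ _] := ap.
have dE : mxdiv (fun _ _ => a) (F - E - F).
  by rewrite addrAC subrr add0r; apply/mxdivN/mul_invmx_div.
split=> //; apply: (approximate_of_error a2 ap) => //.
  apply: (compatible_congr a1 _ (conj uF cF)).
  by apply: mxdiv_le dE => x y; rewrite subnn addn0.
by rewrite (newton_step _ _ (B := B)) // mulmxKV // unit_GF.
Qed.

(** The new error is A - 2(X + X^T) + 4 X V X^T with V = (F G F^T)^-1 congruent
    to Z^-1 modulo 2. The first congruence on X makes it divisible by 4. On the
    diagonal, X V X^T is congruent modulo 2 to the sum of the X_kl (Z^-1)_ll, so
    that the second congruence gives divisibility by 8. *)
Lemma unimodular_start n (F G Z : 'M[Zp]_n) : p = 2%N -> unimodular G ->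
  approximate (fun=> 0%N) 1 F G Z ->
  succeeds (hensel_unimodular_start F G Z) (fun F' =>
    mxdiv (fun _ _ => 1%N) (F' - F) /\ approximate (fun=> 0%N) 2 F' G Z).
Proof.
move=> p2 uG ap; have [sG _] := uG.
have /approximate_const [[_ sZ uF] [dA eA] [_ oA]] := ap.
have sA := error_sym F sG sZ.
rewrite /hensel_unimodular_start.
set A := _ - Z in dA eA oA sA *.
have uGF := unit_GF uG uF.
have uZ : Z \in unitmx.
  rewrite -(@unitmx_congr _ _ _ (F *m G *m F^T)).
    by rewrite !unitmx_mul uF unitmx_tr uF; case: uG => _ ->.
  by move=> x y; have := dA x y; rewrite expn1.
apply/succeeds_bind/succeeds_select.
  have : mx_zero_mod 2 A by move=> x y; have := dA x y; rewrite expn1 -p2.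
  by move/mx_zero_modP => [A2 eA2]; exists A2.
move=> A2 eA2; apply/succeeds_bind/succeeds_select.
  have h k : exists c, 4%:R * c = A k k.
    by have [c ec] := eA p2 k; exists c; rewrite ec (expn_two p2).
  by exists (fun k => projT1 (cid (h k))) => k; case: cid.
move=> d ed; apply/succeeds_bind/succeeds_ensure => //.
apply/succeeds_bind/succeeds_select.
  apply: start_solvable eA2 ed _ => // v oZ x y.
  exact: (oA p2 erefl v oZ).
move=> X [eX hX].
apply/succeeds_bind/succeeds_rdiv_unit => //.
apply: succeeds_ret.
apply: newton_update => //.
  by move=> x y; rewrite mxE expn1; exists (X x y); congr (_%:R * _); rewrite p2.
set E := _ *m invmx _.
pose Y := invmx (G *m F^T); pose V := Y *m G *m Y^T.
(* V is the inverse of F G F^T, hence congruent to Z^-1 modulo 2. *)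
have WV : F *m G *m F^T *m V = 1%:M.
  have -> : F *m G *m F^T *m V = F *m ((G *m F^T) *m Y) *m G *m Y^T.
    by rewrite /V !mulmxA.
  rewrite mulmxV // mulmx1 -[F]trmxK -{1}sG -trmx_mul -trmx_mul mulVmx //.
  by rewrite trmx1.
have sV : V^T = V by rewrite /V !trmx_mul trmxK sG mulmxA.
have eV : V - invmx Z = - (invmx Z *m A *m V).
  rewrite /A mulmxBr mulmxBl -[invmx Z *m _ *m V]mulmxA WV mulmx1 mulVmx //.
  by rewrite mul1mx opprB.
have rV l : residue (V l l) = residue (invmx Z l l).
  apply/eqP; rewrite -subr_eq0 -rmorphB; apply/eqP/zero_modP.
  have : mxdiv (fun _ _ => 1%N) (V - invmx Z).
    rewrite eV; apply/mxdivN.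
    apply: (mxdivM (f := fun _ _ => 1%N) _ _ (mxdiv0 _)) => //.
    exact: (mxdivM _ (mxdiv0 _) dA).
  by move/(_ l l); rewrite !mxE expn1.
have eE : E *m G *m E^T = 4%:R *: (X *m V *m X^T).
  rewrite /E /V -/Y -scalemxAl linearZ /= -!scalemxAl -scalemxAr scalerA -natrM.
  by rewrite trmx_mul !mulmxA.
have [Q eQ] := mx_zero_modP eX.
have eB : A - (2%:R *: X + (2%:R *: X)^T) = - (4%:R *: Q).
  rewrite -eA2 linearZ /= -scalerDr -scalerBr -[A2 - _]opprB eQ scalerN.
  by rewrite scalerA -natrM.
split=> [x y|_ k].
  rewrite eB eE maxn0 addn0 (expn_two p2) -scalerN -scalerDr mxE.
  by eexists.
have -> : (A - (2%:R *: X + (2%:R *: X)^T) + E *m G *m E^T) k k =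
    (p ^ 2)%:R * (d k - X k k + (X *m V *m X^T) k k).
  have entry (P Q' R : 'M[Zp]_n) : (P - Q' + R) k k = P k k - Q' k k + R k k.
    by rewrite !mxE.
  rewrite entry eE (expn_two p2) -ed [(4%:R *: (X *m V *m X^T)) k k]mxE.
  rewrite (_ : (2%:R *: X + (2%:R *: X)^T) k k = 4%:R * X k k).
    by ring.
  by rewrite !mxE; ring.
rewrite addn0 expnD; apply: zero_modM; first exact: zero_mod_nat.
rewrite expn1; apply/zero_modP.
have -> : (X *m V *m X^T) k k = (row k X *m V *m (row k X)^T) 0 0.
  by rewrite -row_mul tr_row !mxE; apply: eq_bigr => l _; rewrite !mxE.
rewrite rmorphD /= residue_form //.
have -> : residue (\sum_l row k X 0 l * V l l) =
          residue (\sum_l X k l * invmx Z l l).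
  rewrite !rmorph_sum; apply: eq_bigr => l _ /=.
  by rewrite mxE !rmorphM /= rV.
have := hX k; rewrite -p2 => /zero_modP; rewrite rmorphB rmorphD /= => hk.
rewrite rmorphB /= -{1}(subr0 (residue (d k))) -{1}hk.
have idem (x : 'F_p) : x * x = x by apply: Fp_idem.
set x := residue (X k k); set y := residue (\sum_l _); set z := residue _.
have -> : z - (x + y - z) - x + y = (z + z) - (x + x) by ring.
by rewrite !idem_add // subrr.
Qed.

(** With A = N + N^T + D and B = N + D/2, the diagonal D is divisible by
    2^(a'+1) by condition (ii), so B is divisible by 2^a' and the new error by
    2^(2a'); precision 2a' - 1 leaves the extra factor 2 for the diagonal. *)
Lemma unimodular_even fuel n (F G Z : 'M[Zp]_n) a b :
  p = 2%N -> (1 <= a)%N -> (b - a <= fuel)%N -> unimodular G ->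
  approximate (fun=> 0%N) a F G Z ->
  succeeds (hensel_unimodular_even fuel F G Z a b) (fun F' =>
    mxdiv (fun _ _ => a) (F' - F) /\ approximate (fun=> 0%N) (maxn a b) F' G Z).
Proof.
move=> p2 a1 fu uG ap; apply/succeeds_bind.
pose Inv (s : 'M[Zp]_n * nat) := [/\ (a <= s.2)%N, (2 <= s.2)%N,
  mxdiv (fun _ _ => a) (s.1 - F) & approximate (fun=> 0%N) s.2 s.1 G Z].
suff : succeeds (if a == 1%N then
    bind (hensel_unimodular_start F G Z) (fun F' => ret (F', 2%N))
    else ret (F, a)) Inv.
  apply: succeeds_impl => s Is; apply/succeeds_bind.
  apply: succeeds_impl (succeeds_while (Inv := Inv) (mu := fun s => (b - s.2)%N) _ _ Is _).
  - move=> [F' a'] [[/= aa' _ dF ap'] ge_b]; apply: succeeds_ret => /=.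
    by split=> //; apply: approximate_le ap'; lia.
  - by move=> s' _ /=; lia.
  - move=> {s Is} [F' a'] [/= aa' a2 dF ap'] lt_b.
    have /approximate_const [[sG sZ uF] [dA eA] _] := ap'.
    have sA := error_sym F' sG sZ.
    set A := _ - Z in dA eA sA *.
    apply/succeeds_bind/succeeds_select.
      exists (upper_part A, diag_mx (\row_k A k k)) => /=; split.
      + by move=> k l lk; rewrite mxE ltnNge lk.
      + exact: diag_mx_is_diag.
      + exact: symmetric_decomposition.
    move=> [N D] /= [upN dD eND].
    have divN : mxdiv (fun _ _ => a') N.
      move=> k l; have [lk|kl] := leqP l k; first by rewrite upN //; apply: zero_mod0.
      have := dA k l; rewrite maxn0 addn0 eND !mxE (upN l k) ?(ltnW kl) // addr0.
      by rewrite (is_diag_mxP dD) ?addr0 // neq_ltn kl.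
    have divD : mxdiv (fun _ _ => a'.+1) D.
      move=> k l; have [<-|kl] := eqVneq k l; last first.
        by rewrite (is_diag_mxP dD) //; apply: zero_mod0.
      by have := eA p2 k; rewrite addn0 addn1 eND !mxE (upN k k) // !add0r.
    apply/succeeds_bind/succeeds_select.
      have : mx_zero_mod 2 D.
        move=> x y; rewrite -p2 -[p in zero_mod p]expn1.
        by apply: zero_mod_exp (divD x y).
      by case/mx_zero_modP => D2 ->; exists D2.
    move=> D2 eD2; have divD2 := divn_two_div p2 eD2 divD.
    have uGF := unit_GF uG uF.
    apply/succeeds_bind/succeeds_rdiv_unit => //; apply: succeeds_ret.
    have dB : mxdiv (fun _ _ => a') (N + D2) by apply: mxdivD.
    have eB : N + D2 + (N + D2)^T = A.
      have -> : (N + D2)^T = N^T + D2.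
        have sD : D^T = D.
          apply/matrixP => k l; rewrite mxE; have [<-//|kl] := eqVneq k l.
          by rewrite !(is_diag_mxP dD) // eq_sym.
        have : (p ^ 1)%:R *: D2^T = (p ^ 1)%:R *: D2.
          by rewrite (expn_two p2) -linearZ /= eD2.
        by rewrite linearD /= => /scalemx_natXI ->.
      by rewrite eND -eD2; apply/matrixP => x y; rewrite !mxE; ring.
    have a'1 : (1 <= a')%N by lia.
    have a'2 : (2 <= 2 * a' - 1)%N by lia.
    have [] := newton_update a'1 a'2 uG ap' dB.
      rewrite -/A eB subrr add0r; apply: small_error_div.
      set E := _ *m invmx _; have dE : mxdiv (fun _ _ => a') E.
        exact: mul_invmx_div.
      by apply: mxdiv_le (form_div G dE) => x y; lia.
    move=> dE ap''; split=> /=; last by lia.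
    split=> //=; try lia.
    rewrite -[_ - F](subrKA F'); apply: mxdivD => //.
    by apply: mxdiv_le dE.
  - by case: Is => /= *; lia.
case: eqP => [a1'|a1']; last first.
  apply: succeeds_ret; split=> //=; first by lia.
  by move=> x y; rewrite subrr mxE; apply: zero_mod0.
subst a; apply/succeeds_bind.
apply: succeeds_impl (unimodular_start p2 uG ap) => F' [dF ap'].
by apply: succeeds_ret; split.
Qed.

Lemma two_unit : p != 2%N -> (2%:R : Zp) \is a GRing.unit.
Proof.
move=> p2; rewrite padic_unitE rmorph_nat -(dvdn_pcharf (pchar_Fp pp)).
by rewrite dvdn_prime2.
Qed.

(** As 2 is invertible, B = A/2 is as divisible as A. *)
Lemma unimodular_odd fuel n (F G Z : 'M[Zp]_n) a b :
  p != 2%N -> (1 <= a)%N -> (b - a <= fuel)%N -> unimodular G ->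
  approximate (fun=> 0%N) a F G Z ->
  succeeds (hensel_unimodular_odd fuel F G Z a b) (fun F' =>
    mxdiv (fun _ _ => a) (F' - F) /\ approximate (fun=> 0%N) (maxn a b) F' G Z).
Proof.
move=> p2 a1 fu uG ap; apply/succeeds_bind; have u2 := two_unit p2.
pose Inv (s : 'M[Zp]_n * nat) := [/\ (a <= s.2)%N,
  mxdiv (fun _ _ => a) (s.1 - F) & approximate (fun=> 0%N) s.2 s.1 G Z].
apply: succeeds_impl (succeeds_while (Inv := Inv) (mu := fun s => (b - s.2)%N) _ _ _ _).
- move=> [F' a'] [[/= aa' dF ap'] ge_b]; apply: succeeds_ret => /=.
  by split=> //; apply: approximate_le ap'; lia.
- by move=> s' _ /=; lia.
- move=> [F' a'] [/= aa' dF ap'] lt_b.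
  have /approximate_const [[sG sZ uF] [dA _] _] := ap'.
  have sA := error_sym F' sG sZ.
  set A := _ - Z in dA sA *.
  apply/succeeds_bind/succeeds_select.
    by exists (2%:R^-1 *: A); rewrite scalerA mulrV // scale1r.
  move=> B eB2.
  have eB : B = 2%:R^-1 *: A by rewrite -eB2 scalerA mulVr // scale1r.
  have uGF := unit_GF uG uF.
  apply/succeeds_bind/succeeds_rdiv_unit => //; apply: succeeds_ret.
  have dB : mxdiv (fun _ _ => a') B.
    by move=> x y; rewrite eB mxE; apply: zero_modMl; have := dA x y; rewrite addn0.
  have eBB : B + B^T = A.
    by rewrite -eB2 {2}eB linearZ /= sA -eB scaler_nat mulr2n.
  have a'1 : (1 <= a')%N by lia.
  have a'2 : (2 <= 2 * a')%N by lia.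
  have [] := newton_update a'1 a'2 uG ap' dB.
    rewrite -/A eBB subrr add0r.
    set E := _ *m invmx _; have dE : mxdiv (fun _ _ => a') E.
      exact: mul_invmx_div.
    split; last by move=> /eqP; rewrite (negbTE p2).
    by apply: mxdiv_le (form_div G dE) => x y; lia.
  move=> dE ap''; split=> /=; last by lia.
  split=> //=; try lia.
  rewrite -[_ - F](subrKA F'); apply: mxdivD => //.
  by apply: mxdiv_le dE.
- by split=> //= x y; rewrite subrr mxE; apply: zero_mod0.
- by [].
Qed.

Lemma unimodular_correct fuel n (F G Z : 'M[Zp]_n) a b :
  (1 <= a)%N -> (b - a <= fuel)%N -> unimodular G ->
  approximate (fun=> 0%N) a F G Z ->
  succeeds (hensel_unimodular fuel F G Z a b) (fun F' =>
    mxdiv (fun _ _ => a) (F' - F) /\ approximate (fun=> 0%N) (maxn a b) F' G Z).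
Proof.
move=> a1 fu uG ap; apply/succeeds_bind/succeeds_ensure; first by split.
case: eqP => [p2|/eqP p2]; first exact: unimodular_even.
exact: unimodular_odd.
Qed.

End Unimodular.

(** * The general procedure *)

Lemma reshape_index_head n rs k : (k < n)%N -> reshape_index (n :: rs) k = 0%N.
Proof. by rewrite /reshape_index /= -subn_eq0 => ->. Qed.

Lemma reshape_index_tail n rs k :
  reshape_index (n :: rs) (n + k) = (reshape_index rs k).+1.
Proof. by rewrite /reshape_index /= -addnS addKn. Qed.

(** The block containing a given row is not empty, so it does not precede the
    first nonempty block. *)
Lemma find_le_reshape_index rs k : (k < sumn rs)%N ->
  (find (fun m => m != 0%N) rs <= reshape_index rs k)%N.
Proof.
move=> /reshape_offsetP lt_k; rewrite leqNgt; apply/negP => lt_find.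
by have := before_find 0%N lt_find; rewrite -lt0n (leq_ltn_trans _ lt_k).
Qed.

Lemma find_lt_size rs : sumn rs != 0%N ->
  (find (fun m => m != 0%N) rs < size rs)%N.
Proof.
move=> rs0; rewrite -has_find; apply: contraNT rs0 => /hasPn h.
rewrite sumnE big_seq big1 // => m /h; by rewrite negbK => /eqP.
Qed.

Section Correctness.
Variables (p : nat) (pp : prime p).
Local Notation Zp := (padic pp).

Lemma approximate_empty r (lev : 'I_r -> nat) a (F G Z : 'M[Zp]_r) :
  r = 0%N -> approximate lev a F G Z.
Proof.
move=> r0; subst r; apply/approximateP; split.
- by split=> [||[]//]; rewrite [LHS]flatmx0 [RHS]flatmx0.
- by split=> [|[]//]; rewrite unitmxE det_mx00 unitr1.
- by split=> [[]|_ []].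
- by move=> i; apply: local_ok_empty; apply: block_empty; case.
Qed.

Lemma approximate_unimodular n a (F G Z : 'M[Zp]_n) :
  approximate (fun=> 0%N) a F G Z -> unimodular G.
Proof.
by move=> /approximate_const [_ _ [[S uS ->] _]]; rewrite expn0 scale1r.
Qed.

Section OffDiagonal.
Variables (m n i s : nat) (L : 'I_n -> nat).
Hypothesis iL : forall k, (i + s <= L k)%N.

(** With P = D G F21^T, where G is p^i G1, the difference is
    - (P + P^T) + D G D^T. Entry (k, l) of P is divisible by p to the power
    a + L k + L l - i, at least a + s + max(L k, L l) as min(L k, L l) >= i + s.
    On the diagonal P + P^T gives an additional factor 2, and D G D^T has at
    least a >= 1 further powers of p. *)
Lemma off_diagonal_error a (G1 : 'M[Zp]_m) (F21 D : 'M[Zp]_(n, m)) :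
  (1 <= a)%N -> G1^T = G1 ->
  mxdiv (fun k _ => L k - i)%N F21 -> mxdiv (fun k _ => a + L k - i)%N D ->
  small_error L (a + s) ((F21 - D) *m ((p ^ i)%:R *: G1) *m (F21 - D)^T
                         - F21 *m ((p ^ i)%:R *: G1) *m F21^T).
Proof.
move=> a1 sG dF dD; pose G := (p ^ i)%:R *: G1.
have dG : mxdiv (fun _ _ => i + 0)%N G by apply/mxdiv_scale/mxdiv0.
pose P := D *m G *m F21^T.
have -> : (F21 - D) *m G *m (F21 - D)^T - F21 *m G *m F21^T =
    - (P + P^T) + D *m G *m D^T.
  rewrite /P !trmx_mul trmxK (_ : G^T = G); last by rewrite /G linearZ /= sG.
  rewrite linearB /= !(mulmxBl, mulmxBr) !mulmxA.
  by apply/matrixP => x y; rewrite !mxE; ring.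
have dDG : mxdiv (fun k _ => a + L k)%N (D *m G).
  by apply: (mxdivM _ dD dG) => x z y; have := iL x; lia.
have dP : mxdiv (fun k l => a + s + maxn (L k) (L l))%N P.
  apply: (mxdivM _ dDG (mxdiv_tr dF)) => x z y.
  by have := iL x; have := iL y; lia.
apply: small_errorD; last first.
  apply: small_error_div; apply: (mxdivM _ dDG (mxdiv_tr dD)) => x z y.
  by have := iL x; have := iL y; lia.
apply: small_errorN; split.
  apply: mxdivD => //; apply: mxdiv_le (mxdiv_tr dP) => x y.
  by rewrite maxnC.
move=> p2 k; rewrite !mxE -mulr2n -mulr_natl addnC expnD expn1.
apply: zero_modM; last by have := dP k k; rewrite maxnn mxE.
by rewrite -p2; apply: zero_mod_nat.
Qed.

(** Multiplying F21 - X by G1 F11^T, which is p^i times an invertible matrix,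
    gives the old error of the equation plus the effect of the change of F22;
    row k of both is divisible by p^(a + L k). *)
Lemma off_diagonal_update a (F11 : 'M[Zp]_m) F12 F21 F22 F22' G1 (G2 : 'M[Zp]_n)
    Z21 X :
  G1 *m F11^T \in unitmx -> mxdiv (fun k _ => L k) G2 ->
  mxdiv (fun k _ => a + L k)%N
    (F21 *m ((p ^ i)%:R *: G1) *m F11^T + F22 *m G2 *m F12^T - Z21) ->
  mxdiv (fun k l => a + (L k - L l))%N (F22' - F22) ->
  X *m ((p ^ i)%:R *: G1 *m F11^T) = Z21 - F22' *m G2 *m F12^T ->
  mxdiv (fun k _ => a + L k - i)%N (F21 - X).
Proof.
move=> uU dG2 dR dF eX.
have eR : (p ^ i)%:R *: ((F21 - X) *m (G1 *m F11^T)) =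
    (F21 *m ((p ^ i)%:R *: G1) *m F11^T + F22 *m G2 *m F12^T - Z21)
    + (F22' - F22) *m G2 *m F12^T.
  rewrite scalemxAr scalemxAl mulmxBl eX mulmxBl mulmxBl mulmxA.
  by apply/matrixP => x y; rewrite !mxE; ring.
rewrite -[F21 - X](mulmxK uU).
apply: (mxdivM (f := fun k _ => (a + L k - i)%N) _ _ (mxdiv0 _)).
  by move=> *; rewrite addn0.
apply: (@mxdiv_cancel _ _ i); rewrite eR.
apply: (@mxdiv_le _ _ _ _ (fun k _ => a + L k)%N) => [x y|].
  by have := iL x; lia.
apply: mxdivD => //.
apply: (mxdivM (f := fun k _ => (a + L k)%N) _ _ (mxdiv0 _)).
  by move=> *; rewrite addn0.
by apply: (mxdivM _ dF dG2) => x z y; lia.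
Qed.

(** The division is exact: the right-hand side differs from the product
    F21 G1 F11^T, where G1 stands for the p^i-modular block, by the old error and
    the effect of the change of F22, and all three are divisible by p^i. *)
Lemma off_diagonal_exists a (F11 : 'M[Zp]_m) F12 F21 F22 F22' G1 (G2 : 'M[Zp]_n)
    Z21 :
  G1 *m F11^T \in unitmx -> mxdiv (fun k _ => L k) G2 ->
  mxdiv (fun k _ => a + L k)%N
    (F21 *m ((p ^ i)%:R *: G1) *m F11^T + F22 *m G2 *m F12^T - Z21) ->
  mxdiv (fun k l => a + (L k - L l))%N (F22' - F22) ->
  exists X, X *m ((p ^ i)%:R *: G1 *m F11^T) = Z21 - F22' *m G2 *m F12^T.
Proof.
move=> uU dG2 dR dF; set T := Z21 - _.
have eT : T = F21 *m ((p ^ i)%:R *: G1) *m F11^T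
    - (F21 *m ((p ^ i)%:R *: G1) *m F11^T + F22 *m G2 *m F12^T - Z21)
    - (F22' - F22) *m G2 *m F12^T.
  by rewrite /T !mulmxBl; apply/matrixP => x y; rewrite !mxE; ring.
have : mx_zero_mod (p ^ i) T.
  have dT : mxdiv (fun _ _ => i) T.
    rewrite eT; apply: mxdivB; first apply: mxdivB.
    - rewrite -mulmxA -scalemxAl -scalemxAr.
      by apply: mxdiv_le (mxdiv_scale i (mxdiv0 _)) => x y; rewrite addn0.
    - by apply: mxdiv_le dR => x y; have := iL x; lia.
    - apply: (mxdivM (f := fun _ _ => i) _ _ (mxdiv0 _)).
        by move=> *; rewrite addn0.
      apply: (mxdivM _ dF dG2) => x z y.
      by have := iL z; lia.
  by [].
case/mx_zero_modP => Q ->; exists (Q *m invmx (G1 *m F11^T)).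
by rewrite -scalemxAl -scalemxAr mulmxKV.
Qed.

End OffDiagonal.

(** Induction on the list of block sizes. The loop keeps F21 and F22 close to
    their initial values, and the last three conditions of [approximate_split]
    at the current precision. *)
Lemma hensel_qf_correct fuel i rs (lev : 'I_(sumn rs) -> nat)
    (F G Z : 'M[Zp]_(sumn rs)) a b :
  (1 <= a)%N -> (1 <= sumn rs)%N -> (b - a <= fuel)%N -> (size rs <= fuel)%N ->
  (forall k, lev k = i + reshape_index rs k)%N ->
  approximate lev a F G Z ->
  succeeds (hensel_qf fuel i F G Z a b) (fun F' =>
    mxdiv (fun k l => a + (lev k - lev l))%N (F' - F) /\
    approximate lev (maxn a b) F' G Z).
Proof.
elim: rs i lev F G Z a b => [//|n rs IH] i lev F G Z a b a1.
case: n lev F G Z => [|n] lev F G Z.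
  move=> rs1 fu sz elev ap; apply: (IH i.+1) => //; first exact: ltnW.
  by move=> k; rewrite elev addSnnS -(reshape_index_tail 0 rs k).
move=> _ fu sz elev; rewrite /= in sz.
pose m := n.+1; pose L (k : 'I_(sumn rs)) := (i.+1 + reshape_index rs k)%N.
have lev_l (k : 'I_m) : lev (lshift (sumn rs) k) = i.
  by rewrite elev reshape_index_head ?addn0 //; exact: (ltn_ord k).
have lev_r (k : 'I_(sumn rs)) : lev (rshift m k) = L k.
  by rewrite elev /= reshape_index_tail addnS.
have iL k : (i < L k)%N by rewrite /L addSn ltnS leq_addr.
move=> ap; have := approximate_blocks lev_l lev_r iL ap.
case=> [G1 [Z1 [eG1 eZ1 eG eZ]]].
have apb := ap; rewrite -[F]submxK eG eZ in apb.
have [ap1 ap2 dF21 dR] := (approximate_split lev_l lev_r iL _ _ _ _ _ _ _ _ _ _).1 apb.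
have uG1 := approximate_unimodular ap1.
have sG1 : G1^T = G1 by case: uG1.
have dG2 := approximate_rows ap2.
apply/succeeds_bind/succeeds_select; first by exists G1; rewrite eG1.
move=> G1' eG1'; have {G1' eG1'}-> : G1' = G1.
  by apply: (@scalemx_natXI _ _ i); rewrite eG1' eG1.
apply/succeeds_bind/succeeds_select; first by exists Z1; rewrite eZ1.
move=> Z1' eZ1'; have {Z1' eZ1'}-> : Z1' = Z1.
  by apply: (@scalemx_natXI _ _ i); rewrite eZ1' eZ1.
apply/succeeds_bind; apply: succeeds_impl (unimodular_correct a1 fu uG1 ap1).
move=> F11 [dF11 ap11].
have uF11 : F11 \in unitmx by case/approximate_const: ap11 => [[]].
have uU := unit_GF uG1 uF11.
(* Replacing the initial upper left block by F11 keeps the lower left error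
   small, since row k of F21 G1 is divisible by p^(L k). *)
have dR' : mxdiv (fun k _ => a + L k)%N
    (dlsubmx F *m ((p ^ i)%:R *: G1) *m F11^T
     + drsubmx F *m drsubmx G *m (ursubmx F)^T - dlsubmx Z).
  have -> : dlsubmx F *m ((p ^ i)%:R *: G1) *m F11^T =
      dlsubmx F *m ((p ^ i)%:R *: G1) *m (ulsubmx F)^T
      + dlsubmx F *m ((p ^ i)%:R *: G1) *m (F11 - ulsubmx F)^T.
    by rewrite -mulmxDr -linearD /= addrC subrK.
  rewrite [_ *m (ulsubmx F)^T + _]addrC -!addrA; apply: mxdivD; last first.
    by rewrite addrA.
  have dFG : mxdiv (fun k _ => L k) (dlsubmx F *m ((p ^ i)%:R *: G1)).
    by apply: (mxdivM _ dF21 (mxdiv_scale i (mxdiv0 _))) => x z y;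
       have := iL x; lia.
  by apply: (mxdivM _ dFG (mxdiv_tr dF11)) => x z y; rewrite addnC.
(* What is left to check once the loop has produced F21 and F22. *)
have assemble F21 F22 a' : (maxn a b <= a')%N ->
    mxdiv (fun k _ => a + L k - i)%N (F21 - dlsubmx F) ->
    mxdiv (fun k l => a + (L k - L l))%N (F22 - drsubmx F) ->
    mxdiv (fun k _ => a' + L k)%N
      (F21 *m ((p ^ i)%:R *: G1) *m F11^T
       + F22 *m drsubmx G *m (ursubmx F)^T - dlsubmx Z) ->
    approximate L a' F22 (drsubmx G)
      (drsubmx Z - F21 *m ((p ^ i)%:R *: G1) *m F21^T) ->
    mxdiv (fun k l => a + (lev k - lev l))%N
      (block_mx F11 (ursubmx F) F21 F22 - F) /\
    approximate lev (maxn a b) (block_mx F11 (ursubmx F) F21 F22) G Z.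
  move=> le_a' d21 d22 dRes ap22; split.
    rewrite -[F in _ - F]submxK opp_block_mx add_block_mx => x y.
    case: (split_ordP x) => x' ->; case: (split_ordP y) => y' ->;
      rewrite ?lev_l ?lev_r.
    - by rewrite block_mxEul subnn addn0; apply: dF11.
    - by rewrite block_mxEur subrr mxE; apply: zero_mod0.
    - rewrite block_mxEdl addnBA; [exact: d21 | exact: ltnW].
    - by rewrite block_mxEdr; apply: d22.
  rewrite {}eG {}eZ.
  apply: (approximate_split lev_l lev_r iL _ _ _ _ _ _ _ _ _ _).2; split.
  - exact: ap11.
  - exact: approximate_le le_a' ap22.
  - rewrite -[F21](subrK (dlsubmx F)); apply: mxdivD => //.
    by apply: mxdiv_le d21 => x y; lia.
  - by apply: mxdiv_le dRes => x y; rewrite leq_add2r.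
case: eqP => [rs0|/eqP rs0].
  apply: succeeds_ret; apply: (assemble _ _ (maxn a b)) => //.
  - by move=> x y; rewrite subrr mxE; apply: zero_mod0.
  - by move=> x y; rewrite subrr mxE; apply: zero_mod0.
  - move=> x y; have := ltn_ord x.
    by rewrite ltnNge (leq_trans (eq_leq rs0) (leq0n x)).
  - exact: approximate_empty.
set s := (find _ rs).+1; have le_s : (s <= size rs)%N by apply: find_lt_size.
have isL k : (i + s <= L k)%N.
  by rewrite /L addSn addnS ltnS leq_add2l find_le_reshape_index.
rewrite eG1.
pose Inv (t : 'M[Zp]_(sumn rs, m) * 'M[Zp]_(sumn rs) * nat) :=
  [/\ [/\ (a <= t.2)%N, mxdiv (fun k _ => a + L k - i)%N (t.1.1 - dlsubmx F) &
      mxdiv (fun k l => a + (L k - L l))%N (t.1.2 - drsubmx F)],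
    mxdiv (fun k _ => t.2 + L k)%N
      (t.1.1 *m ((p ^ i)%:R *: G1) *m F11^T
       + t.1.2 *m drsubmx G *m (ursubmx F)^T - dlsubmx Z)
  & approximate L t.2 t.1.2 (drsubmx G)
      (drsubmx Z - t.1.1 *m ((p ^ i)%:R *: G1) *m t.1.1^T)].
apply/succeeds_bind.
apply: succeeds_impl
  (succeeds_while (Inv := Inv) (mu := fun t => (b - t.2)%N) _ _ _ _).
- move=> [[F21 F22] a'] [[[/= aa' d21 d22] dRes ap22] ge_b].
  have le_a' : (maxn a b <= a')%N by lia.
  exact: succeeds_ret (assemble _ _ a' le_a' d21 d22 dRes ap22).
- by move=> t _ lt_b; rewrite subn_gt0; exact: lt_b.
- move=> [[F21 F22] a'] [[/= aa' d21 d22] dRes ap22] lt_b.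
  have a'1 : (1 <= a')%N by lia.
  apply/succeeds_bind.
  have rs1 : (1 <= sumn rs)%N by rewrite lt0n.
  have fu' : (a' + s - a' <= fuel)%N by rewrite addKn; lia.
  have sz' : (size rs <= fuel)%N by lia.
  apply: succeeds_impl
    (IH i.+1 L _ _ _ a' (a' + s)%N a'1 rs1 fu' sz' (fun=> erefl) ap22).
  rewrite (maxn_idPr (leq_addr _ _)) => F22' [d22' ap22'].
  apply/succeeds_bind/succeeds_rdiv.
  + by rewrite -scalemxAl detZ mulf_neq0 ?expf_neq0 ?padic_natX_neq0 //;
       move: uU; rewrite unitmxE; apply: contraTneq => ->; rewrite unitr0.
  + exact: projT2 (cid (off_diagonal_exists isL uU dG2 dRes d22')).
  move=> F21' eF21'; apply: succeeds_ret.
  have dD := off_diagonal_update isL uU dG2 dRes d22' eF21'.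
  have dF21' : mxdiv (fun k _ => L k - i)%N F21.
    rewrite -[F21](subrK (dlsubmx F)); apply: mxdivD => //.
    by apply: mxdiv_le d21 => x y; lia.
  split; last by move=> /=; lia.
  split=> /=.
  + split; first lia.
    * rewrite -[_ - dlsubmx F](subrKA F21) -opprB; apply: mxdivD => //.
      by apply/mxdivN; apply: mxdiv_le dD => x y; lia.
    * rewrite -[_ - drsubmx F](subrKA F22); apply: mxdivD => //.
      by apply: mxdiv_le d22' => x y; lia.
  + rewrite -[F21' *m _ *m _]mulmxA eF21' subrK subrr => x y.
    by rewrite mxE; apply: zero_mod0.
  + have /approximateP [[sG2 sZ _] cF e22 _] := ap22'.
    have a's2 : (2 <= a' + s)%N by lia.
    have sZ' : (drsubmx Z - F21' *m ((p ^ i)%:R *: G1) *m F21'^T)^T =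
        drsubmx Z - F21' *m ((p ^ i)%:R *: G1) *m F21'^T.
      rewrite linearB /= trmx_drsub (approx_symZ ap) !trmx_mul trmxK linearZ /= sG1.
      by rewrite mulmxA.
    apply: (approximate_of_error a's2 ap22' sZ' cF).
    have := off_diagonal_error isL a'1 sG1 dF21' dD.
    rewrite subKr => e21.
    have := small_errorD e22 e21.
    set P := F21' *m _ *m _; set Q := F21 *m _ *m _.
    have telescope (X Y U V : 'M[Zp]_(sumn rs)) : X - (Y - U) + (V - U) = X - (Y - V).
      by apply/matrixP => x y; rewrite !mxE; ring.
    by rewrite telescope.
- split=> //=; split=> // x y; rewrite subrr mxE; exact: zero_mod0.
- by [].
Qed.

End Correctness.

Theorem mainTheorem3 (p : nat) (pp : prime p) (a b : nat) (ha : (1 <= a)%N)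
    (rs : seq nat) (hr : (1 <= sumn rs)%N)
    (F G Z : 'M[padic pp]_(sumn rs))
    (hFGZ : approximate (reshape_index rs) a F G Z) :
  exists fuel : nat,
    (exists o, hensel_qf fuel 0 F G Z a b o) /\
    forall o, hensel_qf fuel 0 F G Z a b o ->
      exists F' : 'M[padic pp]_(sumn rs),
        [/\ o = Some F',
            forall i j, mx_zero_mod (p ^ (a + (i - j)))
                          (block (reshape_index rs) (F' - F) i j)
          & approximate (reshape_index rs) b F' G Z].
Proof.
pose lev (k : 'I_(sumn rs)) := reshape_index rs k.
exists (maxn (b - a) (size rs)).
have [ex correct] := @hensel_qf_correct _ pp (maxn (b - a) (size rs)) 0 rs lev
  F G Z a b ha hr (leq_maxl _ _) (leq_maxr _ _) (fun=> erefl) hFGZ.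
split=> // o /correct [F' -> [dF apF]]; exists F'; split=> //.
  exact: ((blockP lev (fun i j x => zero_mod (p ^ (a + (i - j))) x) _).2 dF).
by apply: approximate_le apF; apply: leq_maxr.
Qed.
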